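(* For every $n=1,2,3,\dots$: (1) The Weyl polynomial $W_{\partial B^{n+1}}^{\infty}$ of infinite index, as well as the Weyl polynomials $W_{\partial B^{n+1}}^{p}$ of arbitrary finite index $p=1,2,\dots$, are conservative. (2) The Weyl polynomials $W_{\partial(B^n\times 0)}^{p}$ of index $p=1$, $p=2$ and $p=4$ are conservative. (3) The Weyl polynomial $W_{\partial Q^{n+1}}^{\infty}$ of infinite index, as well as the Weyl polynomials $W_{\partial Q^{n+1}}^{p}$ of arbitrary finite index $p=1,2,\dots$, are conservative. (4) The Weyl polynomial $W_{\partial(Q^n\times 0)}^{\infty}$ of infinite index, as well as the Weyl polynomials $W_{\partial(Q^n\times 0)}^{p}$ of arbitrary finite index $p=1,2,\dots$, are conservative.
   Context: $B^m=\{x\in\mathbb{R}^m:\sum_{k}|x_k|^2\le1\}$ is the unit ball and $Q^m=\{x\in\mathbb{R}^m:\max_k|x_k|\le1\}$ the unit cube. For $K\subset\mathbb{R}^n$, $K\times0=\{(x,0):x\in K\}\subset\mathbb{R}^{n+1}$ is the squeezed cylinder with base $K$. For any compact convex set $V\subset\mathbb{R}^{n+1}$ (possibly with empty interior), let $s_k(V)$ be the coefficients of its Steiner polynomial: $\mathrm{Vol}_{n+1}(V+tB^{n+1})=\sum_{k=0}^{n+1}s_k(V)t^k$ for $t\ge0$. The Weyl coefficients of the $n$-dimensional boundary surface $\mathscr{M}=\partial V$ (proper if $V$ has non-empty interior, improper otherwise) are by definition $w_{2l}(\mathscr{M})=2^l\frac{\Gamma(l+\frac12+1)}{\Gamma(\frac12+1)}s_{2l+1}(V)$,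 $0\le l\le[n/2]$. The Weyl polynomials are $W_{\mathscr{M}}^{p}(t)=\sum_{l=0}^{[n/2]}\frac{2^{-l}\Gamma(\frac p2+1)}{\Gamma(\frac p2+l+1)}w_{2l}(\mathscr{M})t^{2l}$ for $p=1,2,3,\dots$, and $W_{\mathscr{M}}^{\infty}(t)=\sum_{l=0}^{[n/2]}w_{2l}(\mathscr{M})t^{2l}$. A polynomial is conservative if all its roots are purely imaginary and simple. *)

(* Defs.v *)
From HB Require Import structures.
From mathcomp Require Import all_boot all_order all_algebra.
From mathcomp Require Import all_classical all_reals all_analysis.
From mathcomp Require Import complex.

Set Implicit Arguments.
Unset Strict Implicit.
Unset Printing Implicit Defensive.
Import Order.TTheory GRing.Theory Num.Theory.
Import numFieldNormedType.Exports.
Local Open Scope classical_set_scope.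
Local Open Scope ring_scope.

(* The library has no Lebesgue measure on R^m: it is built here on m-tuples as
   the iterated product of the one-dimensional Lebesgue measure. *)
Section cons_measure.
Context (R : realType) (n : nat).
Notation mR := (measurableTypeR R).
Variable mu : {sigma_finite_measure set (n.-tuple mR) -> \bar R}.

Definition cons_pair (p : mR * n.-tuple mR) : n.+1.-tuple mR :=
  [tuple of p.1 :: p.2].

Definition cons_measure : set (n.+1.-tuple mR) -> \bar R :=
  pushforward (lebesgue_measure \x mu)%E cons_pair.

Lemma measurable_cons_pair : measurable_fun [set: mR * n.-tuple mR] cons_pair.
Proof. exact: measurable_cons. Qed.

Let cons_measure0 : cons_measure set0 = 0%E.
Proof. by rewrite /cons_measure /pushforward preimage_set0 measure0. Qed.

Let cons_measure_ge0 A : (0 <= cons_measure A)%E.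
Proof. exact: (measure_ge0 (lebesgue_measure \x mu)%E). Qed.

Let cons_measure_sigma_additive : semi_sigma_additive cons_measure.
Proof.
move=> F mF tF mUF; rewrite /cons_measure /pushforward preimage_bigcup.
have mP A : measurable A -> measurable (cons_pair @^-1` A).
  by move=> mA; rewrite -[X in measurable X]setTI; exact: measurable_cons_pair.
apply: measure_semi_sigma_additive.
- by move=> k; apply: mP; exact: mF.
- apply/trivIsetP => /= i j _ _ ij; rewrite -preimage_setI.
  by move/trivIsetP : tF => /(_ _ _ _ _ ij) ->//; rewrite preimage_set0.
- by rewrite -preimage_bigcup; exact: mP.
Qed.

HB.instance Definition _ := isMeasure.Build _ _ _ cons_measure
  cons_measure0 cons_measure_ge0 cons_measure_sigma_additive.

Let cons_measure_sigma_finite : sigma_finite setT cons_measure.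
Proof.
have /sigma_finiteP[F [TF ndF Foo]] := sigma_finiteT (@lebesgue_measure R).
have /sigma_finiteP[G [TG ndG Goo]] := sigma_finiteT mu.
pose uncons (t : n.+1.-tuple mR) := (thead t, [tuple of behead t]).
have consK : cancel cons_pair uncons.
  by move=> [x t]; rewrite /uncons theadE; congr pair; exact: val_inj.
exists (fun k => uncons @^-1` (F k `*` G k)).
  apply/esym; rewrite -subTset => t _.
  have [i _ Fi] : (\bigcup_i F i) (uncons t).1 by rewrite -TF.
  have [j _ Gj] : (\bigcup_i G i) (uncons t).2 by rewrite -TG.
  exists (maxn i j) => //; split.
  - by move: Fi; exact/subsetPset/ndF/leq_maxl.
  - by move: Gj; exact/subsetPset/ndG/leq_maxr.
move=> k; have [mF Fk] := Foo k; have [mG Gk] := Goo k; split.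
  rewrite -[X in measurable X]setTI.
  apply: measurable_fun_pair; [|exact: measurable_behead|
    exact: measurableT|exact: measurableX].
  exact: measurable_tnth.
rewrite /cons_measure /pushforward.
have -> : cons_pair @^-1` (uncons @^-1` (F k `*` G k)) = F k `*` G k.
  by apply/funext => p; rewrite /preimage /mkset consK.
rewrite product_measure1E// lte_mul_pinfty//.
by rewrite ge0_fin_numE.
Qed.

HB.instance Definition _ :=
  Measure_isSigmaFinite.Build _ _ _ cons_measure cons_measure_sigma_finite.
End cons_measure.

Fixpoint tuple_lebesgue (R : realType) (m : nat) :
    {sigma_finite_measure set (m.-tuple (measurableTypeR R)) -> \bar R} :=
  match m with
  | 0 => \d_[tuple]
  | m'.+1 => cons_measure (tuple_lebesgue R m')
  end.

Definition unit_ball (R : realType) (m : nat) : set 'rV[R]_m :=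
  [set x : 'rV[R]_m | \sum_k `|x ord0 k| ^+ 2 <= 1].
Arguments unit_ball : clear implicits.

Definition unit_cube (R : realType) (m : nat) : set 'rV[R]_m :=
  [set x : 'rV[R]_m | \big[Num.max/0]_k `|x ord0 k| <= 1].
Arguments unit_cube : clear implicits.

Section Weyl_polynomials.
Context {R : realType}.
Implicit Types (m n l p : nat).

Definition volume m (A : set 'rV[R]_m) : \bar R :=
  tuple_lebesgue R m [set t | A (\row_i tnth t i)].

(* K x 0: the vectors with last coordinate 0 whose other coordinates are in K *)
Definition squeezed n (K : set 'rV[R]_n) : set 'rV[R]_n.+1 :=
  [set x : 'rV[R]_n.+1 | x ord0 ord_max = 0 /\ K (col' ord_max x)].

(* The Minkowski sum V + t B^m *)
Definition parallel_body m (V : set 'rV[R]_m) (t : R) : set 'rV[R]_m :=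
  [set v + t *: b | v in V & b in unit_ball R m].

Definition is_steiner_poly m (V : set 'rV[R]_m) (P : {poly R}) : Prop :=
  (size P <= m.+1)%N /\
  forall t : R, 0 <= t -> volume (parallel_body V t) = P.[t]%:E.

(* Such a P is unique when it exists, which is the case for V compact convex;
   otherwise steiner_poly V is 0. *)
Definition steiner_poly m (V : set 'rV[R]_m) : {poly R} :=
  xget 0 (is_steiner_poly V).

Definition Gamma (x : R) : R :=
  \int[lebesgue_measure]_(t in `]0%R, +oo[) (t `^ (x - 1) * expR (- t)).

(* The Weyl coefficients and polynomials of the boundary of V depend on it only
   through V: the convex set V in R^(n+1) is the argument below, also when its
   interior is empty. *)
Definition weyl_coef n (V : set 'rV[R]_n.+1) (l : nat) : R :=
  2 ^+ l * (Gamma (l%:R + 2^-1 + 1) / Gamma (2^-1 + 1)) *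
  (steiner_poly V)`_(l.*2.+1).

Definition weyl_poly n (V : set 'rV[R]_n.+1) (p : nat) : {poly R} :=
  \sum_(0 <= l < (n./2).+1)
    (2 ^- l * Gamma (p%:R / 2 + 1) / Gamma (p%:R / 2 + l%:R + 1) *
     weyl_coef V l) *: 'X^(l.*2).

Definition weyl_poly_inf n (V : set 'rV[R]_n.+1) : {poly R} :=
  \sum_(0 <= l < (n./2).+1) weyl_coef V l *: 'X^(l.*2).

Definition conservative (P : {poly R}) : Prop :=
  let PC : {poly R[i]} := map_poly (real_complex R) P in
  forall z : R[i], root PC z -> complex.Re z = 0 /\ mup z PC = 1%N.

End Weyl_polynomials.

(* Main.v *)
Require Import Defs.
From mathcomp Require Import all_boot all_order all_algebra.
From mathcomp Require Import all_classical all_reals all_analysis.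
From mathcomp Require Import measurable_realfun complex polyrcf.
From mathcomp Require Import ring lra zify.

(* With v = -t^2 a Weyl polynomial becomes a polynomial in v, and it is
   conservative iff that polynomial has simple positive roots ("posrooted").
   Computing volumes by slicing, the polynomial of infinite index is, up to a
   positive factor and a rescaling of v,
     - for the cubes, Re (1 + i t)^n or Im (1 + i t)^(n+1) / t, whose zeros are
       seen by putting t = tan x;
     - for the ball, the reversal of a Laguerre polynomial, i.e. a Hermite
       polynomial.
   A finite index p multiplies the l-th coefficient by 1 / ((a+1) ... (a+l)) with
   a = p/2. This preserves posrootedness (Laguerre): if G is the image of h for
   the parameter a + 1, the image of (1 - r v) h for the parameter a is
   proportional to v^(-a) e^(rv) (v^(a+1) e^(-rv) G)', so Rolle applies.
   For the squeezed ball, the l-th coefficient is l! C(n, 2l) / ((a+1) ... (a+l)),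
   up to sign. When p = 1 or 4 its sign is evaluated at t = tan x for suitable x:
   for p = 1 by writing it as an integral of positive functions, for p = 4 from a
   closed form. The case p = 2 follows from p = 4 by Rolle. *)

Set Implicit Arguments.
Unset Strict Implicit.
Unset Printing Implicit Defensive.
Import Order.TTheory GRing.Theory Num.Theory.
Import numFieldNormedType.Exports.
Local Open Scope classical_set_scope.
Local Open Scope ring_scope.

(** * Polynomials with simple positive roots *)

Section posrooted.
Variable R : rcfType.
Implicit Types (Q G : {poly R}) (s : seq R) (v : nat -> R).

(** For the squeezed ball, passing from infinite to finite index as above would require l! C(n, 2l)
    to give a posrooted polynomial to begin with. Dividing by l! as well, which is the case a = 0,
    gives [cosp n], which is posrooted; but Rolle leads from a + 1 down to a, never from a = 0 up to
    a = 1/2, 1 or 2. Hence the direct sign computations at a = 1/2 and a = 2; one step down from a =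
    2 then reaches a = 1. On the geometric side no ball volume is evaluated. Ratios of volumes of
    consecutive unit balls enter as positive numbers obeying a two-step recursion, and Gamma enters
    through its positivity and its functional equation. The constants left over, in truth powers of
    pi, disappear into the positive factor and the rescaling of v. *)

Definition posrooted Q := Q != 0 /\ exists s,
  [/\ uniq s, all (fun x => 0 < x) s, all (root Q) s & (size Q <= (size s).+1)%N].

Lemma posrootedP Q : posrooted Q -> exists s,
  [/\ sorted <%R s, all (fun x => 0 < x) s, size Q = (size s).+1 &
      Q = lead_coef Q *: \prod_(x <- s) ('X - x%:P)].
Proof.
move=> [Q0 [s [us ps rs sQ]]].
have sQ' : size Q = (size s).+1.
  by apply/eqP; rewrite eqn_leq sQ max_poly_roots.
exists (sort <=%R s); split.
- by rewrite sort_lt_sorted.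
- by rewrite all_sort.
- by rewrite size_sort.
- apply: all_roots_prod_XsubC; rewrite ?size_sort ?all_sort//.
  by rewrite uniq_rootsE sort_uniq.
Qed.

Lemma posrootedZ (c : R) Q : c != 0 -> posrooted Q -> posrooted (c *: Q).
Proof.
move=> c0 [Q0 [s [us ps rs sQ]]]; split; first by rewrite scale_poly_eq0 negb_or c0.
exists s; split=> //; last by rewrite size_scale.
by apply: sub_all rs => x; rewrite rootZ.
Qed.

Lemma posrooted_scale (k : R) Q : 0 < k -> posrooted Q -> posrooted (Q \Po (k *: 'X)).
Proof.
move=> k0 [Q0 [s [us ps rs sQ]]].
have s2 : size (k *: 'X : {poly R}) = 2%N by rewrite size_scale ?size_polyX ?gt_eqF.
have sz : size (Q \Po (k *: 'X)) = size Q.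
  by rewrite size_comp_poly2.
split; first by rewrite -size_poly_eq0 sz size_poly_eq0.
exists [seq x / k | x <- s]; split.
- rewrite map_inj_uniq// => x y /(congr1 ( *%R^~ k)).
  by rewrite !divfK ?gt_eqF.
- by rewrite all_map; apply: sub_all ps => x /= x0; rewrite divr_gt0.
- rewrite all_map; apply: sub_all rs => x /= /rootP x0; apply/rootP.
  by rewrite horner_comp hornerZ hornerX mulrC divfK ?gt_eqF.
- by rewrite sz size_map.
Qed.

(** Intermediate values, by induction on [d]. The bound [x < v d] makes the root found in (v d, v
    (d+1)) a new one, and [0 <= v d] makes it positive. *)
Lemma alternating_roots Q v d :
  (forall i, (i <= d)%N -> 0 < (-1) ^+ i * Q.[v i]) ->
  (forall i, (i < d)%N -> v i < v i.+1) -> 0 <= v 0%N ->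
  exists s, [/\ size s = d, all (root Q) s, uniq s &
    all (fun x => 0 < x < v d) s] /\ 0 <= v d.
Proof.
elim: d => [|d IH] sQ iv v0; first by exists [::].
have [|||s [[ss rs us bs] vd0]] := IH.
- by move=> i id; apply: sQ; exact: ltnW.
- by move=> i id; apply: iv; exact: ltnW.
- by [].
have lt := iv d (ltnSn d).
have [||x /[!in_itv]/= /andP[vx xv] rx] := @poly_ivtoo _ Q (v d) (v d.+1).
- exact: ltW.
- have := mulr_gt0 (sQ d (leqnSn _)) (sQ d.+1 (leqnn _)).
  rewrite exprS mulN1r !mulNr mulrN mulrACA -expr2 sqrr_sign mul1r.
  by rewrite oppr_gt0.
exists (x :: s); split; last exact: (le_trans vd0 (ltW _)).
split=> /=; rewrite ?ss ?rx//; last first.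
  rewrite (le_lt_trans vd0 vx) xv /=; apply: sub_all bs => y /andP[-> yv].
  exact: (lt_trans yv lt).
rewrite us andbT; apply/negP => /(allP bs) /andP[_ ].
by rewrite ltNge ltW.
Qed.

Lemma alternating_posrooted Q v d :
  (size Q <= d.+1)%N ->
  (forall i, (i <= d)%N -> 0 < (-1) ^+ i * Q.[v i]) ->
  (forall i, (i < d)%N -> v i < v i.+1) -> 0 <= v 0%N -> posrooted Q.
Proof.
move=> sQ aQ iv v0; have [s [[ss rs us bs] _]] := alternating_roots aQ iv v0.
split.
  by apply/eqP => Q0; have := aQ 0%N isT; rewrite Q0 horner0 mulr0 ltxx.
exists s; split=> //; last by rewrite ss.
by apply: sub_all bs => x /andP[].
Qed.

(** The sign of the leading coefficient replaces one evaluation: it is the sign of [Q] at a far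
    enough point, which serves as the last node. *)
Lemma alternating_lead_posrooted Q v d :
  (size Q <= d.+2)%N -> 0 < (-1) ^+ d.+1 * lead_coef Q ->
  (forall i, (i <= d)%N -> 0 < (-1) ^+ i * Q.[v i]) ->
  (forall i, (i < d)%N -> v i < v i.+1) -> 0 <= v 0%N -> posrooted Q.
Proof.
move=> sQ lQ aQ iv v0.
have [|x xP] := @poly_pinfty_gt_lc _ ((-1) ^+ d.+1 *: Q); first by rewrite lead_coefZ.
pose w i := if (i <= d)%N then v i else Num.max x (v d + 1).
apply: (@alternating_posrooted Q w d.+1) => // i; rewrite /w.
- rewrite leq_eqVlt => /predU1P[->|]; last by rewrite ltnS => id; rewrite id; exact: aQ.
  rewrite ltnn -hornerZ; apply: lt_le_trans (xP _ _); first by rewrite lead_coefZ.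
  by rewrite le_max lexx.
- rewrite ltnS => id; rewrite id; have [h|h] := leqP i.+1 d; first exact: iv.
  have -> : i = d by apply/eqP; rewrite eqn_leq id.
  by rewrite lt_max ltrDl ltr01 orbT.
Qed.

Lemma prod_subr0 s : \prod_(x <- s) (0 - x) = (-1) ^+ size s * \prod_(x <- s) x.
Proof.
elim: s => [|x s IH]; first by rewrite !big_nil mulr1.
by rewrite !big_cons IH /= exprS; ring.
Qed.

(* H is v^(-a) e^(rv) times the derivative of v^(a+1) e^(-rv) G(v), so it has a
   root between two consecutive zeros of v^(a+1) e^(-rv) G(v). *)
Lemma posrooted_step G (a r : R) : 0 < a -> 0 <= r -> posrooted G ->
  posrooted ('X * G^`() + (a%:P - r *: 'X) * G).
Proof.
move=> a0 r0 /posrootedP[s [ss ps sG defG]].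
set H := (X in posrooted X).
have c0 : lead_coef G != 0 by rewrite lead_coef_eq0 -size_poly_eq0 sG.
have pr0 : 0 < \prod_(x <- s) x.
  by rewrite big_seq; apply: prodr_gt0 => x /(allP ps).
have G0E : G.[0] = lead_coef G * ((-1) ^+ size s * \prod_(x <- s) x).
  by rewrite {1}defG hornerZ horner_prod -prod_subr0; under eq_bigr do rewrite hornerXsubC.
have G0 : G.[0] != 0 by rewrite G0E !mulf_neq0 ?signr_eq0//; exact: lt0r_neq0.
(* The nodes are 0 and the roots of [G]. There [H] takes the values a G(0) and x G'(x), whose signs
   alternate; the factor G(0) below makes the first one positive. *)
pose v i := nth 0 (0 :: s) i.
have vs i : (i < size s)%N -> v i < v i.+1.
  move=> id; rewrite /v; apply: (@sorted_ltn_nth _ <%R lt_trans 0 (0 :: s)) => //=.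
    by rewrite path_min_sorted.
  by rewrite inE ltnS ltnW.
have vP j : (j <= size s)%N -> 0 < (-1) ^+ j * (G.[0] *: H).[v j].
  case: j => [|i] id.
    rewrite mul1r hornerZ /v /= /H hornerD !hornerM hornerX mul0r add0r.
    rewrite [X in _ * (X * _)]hornerD hornerC hornerN hornerZ hornerX mulr0 oppr0 addr0 mulrCA -expr2.
    by rewrite mulr_gt0// exprn_even_gt0.
  rewrite /v /=.
  set x := nth 0 s i; pose s1 := take i s; pose s2 := drop i.+1 s.
  have sE : s = s1 ++ x :: s2 by rewrite /s1 /s2 -drop_nth// cat_take_drop.
  have s1i : size s1 = i by rewrite size_take id.
  have x0 : 0 < x by apply: (allP ps); exact: mem_nth.
  have rx : G.[x] = 0.
    apply/rootP; rewrite defG rootZ// root_prod_XsubC; exact: mem_nth.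
  pose rest := \prod_(y <- s1) ('X - y%:P) * \prod_(y <- s2) ('X - y%:P).
  have GE : G = lead_coef G *: (('X - x%:P) * rest).
    rewrite {1}defG; congr (_ *: _).
    by rewrite {1}sE big_cat big_cons /= /rest mulrCA.
  have G'x : G^`().[x] = lead_coef G * (\prod_(y <- s1) (x - y) * \prod_(y <- s2) (x - y)).
    rewrite {1}GE derivZ derivM derivXsubC mul1r hornerZ hornerD.
    rewrite [X in _ + X]hornerM hornerXsubC subrr mul0r addr0 hornerM !horner_prod.
    by congr (_ * (_ * _)); apply: eq_bigr => y _; rewrite hornerXsubC.
  move: ss; rewrite {1}sE lt_sorted_pairwise pairwise_cat /= => /and4P[].
  rewrite allrel_consr => /andP[s1x _] _ xs2 _.
  have p1 : 0 < \prod_(y <- s1) (x - y).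
    by rewrite big_seq; apply: prodr_gt0 => y /(allP s1x) yx; rewrite subr_gt0.
  have p2 : 0 < \prod_(y <- s2) (y - x).
    by rewrite big_seq; apply: prodr_gt0 => y /(allP xs2) yx; rewrite subr_gt0.
  have p2' : \prod_(y <- s2) (x - y) = (-1) ^+ size s2 * \prod_(y <- s2) (y - x).
    elim: (s2) => [|y t IH]; first by rewrite !big_nil mulr1.
    by rewrite !big_cons IH /= exprS; ring.
  have szs : size s = (i + (size s2).+1)%N by rewrite sE size_cat s1i.
  rewrite hornerZ /H hornerD !hornerM rx mulr0 addr0 hornerX G'x p2' G0E szs.
  set P1 := \prod_(y <- s1) _ in p1 *; set P2 := \prod_(y <- s2) _ in p2 *.
  set P := \prod_(y <- s) _ in pr0 *.
  have -> : (-1) ^+ i.+1 * (lead_coef G * ((-1) ^+ (i + (size s2).+1) * P) *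
     (x * (lead_coef G * (P1 * ((-1) ^+ size s2 * P2))))) =
     ((-1) ^+ (i + size s2)) ^+ 2 * ((lead_coef G ^+ 2) * (P * x * (P1 * P2))).
    by rewrite !exprS !exprD !exprS; ring.
  by rewrite sqrr_sign mul1r mulr_gt0// ?exprn_even_gt0// !mulr_gt0.
suff : posrooted (G.[0] *: H).
  move=> /(@posrootedZ G.[0]^-1 _); rewrite scalerA mulVf// scale1r; apply.
  by rewrite invr_eq0.
have sX : (size ('X * G^`())%R <= (size s).+1)%N.
  apply: (leq_trans (size_polyMleq _ _)); rewrite size_polyX /=.
  by rewrite -sG -ltnS; apply: leq_trans (lt_size_deriv _) _; rewrite // -size_poly_eq0 sG.
have slG : lead_coef G = G`_(size s) by rewrite lead_coefE sG.
(* For r = 0 the degree is that of [G] and the sign changes between nodes suffice. For r > 0 it is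
   one more, and the extra root lies beyond the roots of [G]: Rolle between the last of them and
   infinity, where e^(-rv) decays. *)
have [r00|rN0] := eqVneq r 0.
  apply: (@alternating_posrooted _ v (size s)) => //.
  apply: leq_trans (size_scale_leq _ _) _.
  rewrite /H r00 scale0r subr0; apply: leq_trans (size_polyD _ _) _.
  rewrite geq_max sX /= -sG; apply: leq_trans (size_polyMleq _ _) _.
  by rewrite size_polyC gt_eqF.
have rp : 0 < r by rewrite lt_neqAle eq_sym rN0.
have HE : H = ('X * G^`() + a *: G) - r *: ('X * G).
  by rewrite /H mulrBl addrA mul_polyC scalerAl.
have sz1 : (size ('X * G^`() + a *: G)%R <= (size s).+1)%N.
  by apply: leq_trans (size_polyD _ _) _; rewrite geq_max sX -sG size_scale_leq.
have Gn : G != 0 by rewrite -size_poly_eq0 sG.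
have sz2 : size (- (r *: ('X * G))) = (size s).+2.
  by rewrite size_polyN size_scale// mulrC size_mulX// sG.
apply: (@alternating_lead_posrooted _ v (size s)) => //.
  apply: leq_trans (size_scale_leq _ _) _.
  by rewrite HE; apply: leq_trans (size_polyD _ _) _; rewrite geq_max sz2 leqnn (leq_trans sz1).
rewrite lead_coefZ HE lead_coefDr ?sz2 ?ltnS//.
rewrite lead_coefN lead_coefZ [X in lead_coef X]mulrC lead_coefMX G0E.
set P := \prod_(y <- s) _ in pr0 *.
have -> : (-1) ^+ (size s).+1 * (lead_coef G * ((-1) ^+ size s * P) * - (r * lead_coef G))
   = ((-1) ^+ size s) ^+ 2 * (lead_coef G ^+ 2 * (P * r)) by rewrite exprS; ring.
by rewrite sqrr_sign mul1r mulr_gt0// ?exprn_even_gt0// mulr_gt0.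
Qed.

End posrooted.

(** * Reversal, Laguerre multipliers, and the passage to conservative polynomials *)

Section more_posrooted.
Variable R : rcfType.
Implicit Types (Q G : {poly R}) (s : seq R) (a : R).

Lemma posrooted_rev Q G d : (size Q = d.+1)%N -> (size G <= d.+1)%N ->
  (forall l, (l <= d)%N -> G`_l = Q`_(d - l)) -> posrooted Q -> posrooted G.
Proof.
move=> sQ sG GQ [Q0 [s [us ps rs szs]]].
have GE x : x != 0 -> G.[x] = x ^+ d * Q.[x^-1].
  move=> x0; rewrite (horner_coef_wide _ sG) horner_coef sQ mulr_sumr.
  rewrite (reindex_inj rev_ord_inj) /=; apply: eq_bigr => i _.
  have id : (i <= d)%N by rewrite -ltnS.
  rewrite subSS GQ ?leq_subr// subKn// mulrCA; congr (_ * _).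
  by rewrite exprVn -expfB_cond ?(negPf x0).
split.
  rewrite -lead_coef_eq0 lead_coefE; apply/eqP => G00.
  have Gd : G`_d = Q`_0 by rewrite GQ// subnn.
  have Q00 : Q`_0 = 0.
    rewrite -Gd; have [l0|] := leqP d.+1 (size G); last by rewrite ltnS => /leq_sizeP/(_ d); apply.
    have szG : size G = d.+1 by apply/eqP; rewrite eqn_leq l0 sG.
    by move: G00; rewrite szG.
  have : all (root Q) (0 :: s) by rewrite /= rs andbT; apply/rootP; rewrite horner_coef0.
  move=> /(max_poly_roots Q0) /=; rewrite us andbT.
  have -> : 0 \notin s by apply/negP => /(allP ps); rewrite ltxx.
  by move=> /(_ isT); rewrite ltnNge szs.
exists [seq x^-1 | x <- s]; split.
- by rewrite map_inj_uniq//; exact: invr_inj.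
- by rewrite all_map; apply: sub_all ps => x /=; rewrite invr_gt0.
- rewrite all_map; apply/allP => x xs /=; apply/rootP.
  rewrite GE ?invrK; last by rewrite invr_eq0 lt0r_neq0// (allP ps).
  by rewrite (rootP (allP rs x xs)) mulr0.
- by rewrite size_map (leq_trans sG)// -sQ.
Qed.

(** The quotient Gamma(a + l + 1) / Gamma(a + 1), as a product, so that a = -1/2 can be used as
    well. *)
Definition rising a l : R := \prod_(i < l) (a + i.+1%:R).

Lemma risingS a l : rising a l.+1 = rising a l * (a + l.+1%:R).
Proof. by rewrite /rising big_ord_recr. Qed.

Lemma rising_recl a l : rising a l.+1 = (a + 1) * rising (a + 1) l.
Proof.
rewrite /rising big_ord_recl /=; congr (_ * _); apply: eq_bigr => i _.
by rewrite -addrA -natr1 [_ + 1]addrC.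
Qed.

Lemma rising_gt0 a l : -1 < a -> 0 < rising a l.
Proof.
move=> a1; apply: prodr_gt0 => i _; rewrite -natr1 addrCA ltr_wpDl ?ler0n//.
by rewrite -ltrBlDr sub0r.
Qed.

Definition laguerre_mult a Q := \poly_(l < size Q) (Q`_l / rising a l).

Lemma coef_laguerre_mult a Q l : (laguerre_mult a Q)`_l = Q`_l / rising a l.
Proof.
by rewrite coef_poly; case: ltnP => // /leq_sizeP ->//; rewrite mul0r.
Qed.

Lemma laguerre_multZ a (c : R) Q : laguerre_mult a (c *: Q) = c *: laguerre_mult a Q.
Proof. by apply/polyP => l; rewrite coefZ !coef_laguerre_mult coefZ mulrA. Qed.

(** Induction on the factors with [a] generalised, since removing a factor moves the parameter to a
    + 1. The coefficients agree because rising a (l + 1) = (a + 1) rising (a + 1) l. *)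
Lemma posrooted_laguerre_prod a s : -1 < a -> all (fun x => 0 < x) s ->
  posrooted (laguerre_mult a (\prod_(r <- s) (1 - r *: 'X))).
Proof.
elim: s a => [|r s IH] a a1.
  move=> _; rewrite big_nil.
  have -> : laguerre_mult a 1 = 1.
    apply/polyP => l; rewrite coef_laguerre_mult coef1.
    by case: l => [|l] /=; rewrite ?mul0r// /rising big_ord0 divr1.
  by split; [exact: oner_neq0|exists [::]; split => //; rewrite size_poly1].
move=> /= /andP[r0 ps]; rewrite big_cons; set h := \prod_(_ <- _) _ in IH *.
have a1p : 0 < a + 1 by rewrite -ltrBlDr sub0r.
have a1' : -1 < a + 1 by apply: lt_trans a1p; rewrite oppr_lt0.
set G := laguerre_mult (a + 1) h.
have /(posrooted_step a1p (ltW r0)) : posrooted G by exact: IH.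
set H := (X in posrooted X).
suff -> : laguerre_mult a ((1 - r *: 'X) * h) = (a + 1)^-1 *: H.
  by apply: posrootedZ; rewrite invr_eq0 gt_eqF.
apply/polyP => l; rewrite coefZ coef_laguerre_mult /H mulrBl mul1r mulrBl mul_polyC.
rewrite coefB coefD coefB -!scalerAl !coefZ !coefXM coef_laguerre_mult.
case: l => [|l] /=.
  rewrite /rising !big_ord0 !divr1 !mulr0 !subr0 add0r mulKf// gt_eqF//.
have r1 := rising_gt0 l a1'; have r2 := rising_gt0 l.+1 a1'.
rewrite rising_recl coef_deriv !coef_laguerre_mult risingS.
have e : a + 1 + l.+1%:R != 0 by rewrite gt_eqF// addr_gt0// ltr0n.
have n1 := lt0r_neq0 r1; have n2 := lt0r_neq0 a1p.
have n3 : rising (a + 1) l * (a + 1 + l.+1%:R) != 0 by rewrite mulf_neq0.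
move: e; rewrite -natr1 => e.
by field; rewrite ?n1 ?n2 ?e.
Qed.

Lemma posrooted_laguerre a Q : -1 < a -> posrooted Q -> posrooted (laguerre_mult a Q).
Proof.
move=> a1 pQ; have Q0 := pQ.1; have [s [_ ps _ ->]] := posrootedP pQ.
have -> : lead_coef Q *: \prod_(x <- s) ('X - x%:P) =
    (lead_coef Q * \prod_(x <- s) - x) *: \prod_(x <- [seq y^-1 | y <- s]) (1 - x *: 'X).
  rewrite -scalerA; congr (_ *: _); rewrite big_map.
  elim: s ps => [|x s IH] /=; first by rewrite !big_nil scale1r.
  move=> /andP[x0 ps]; rewrite !big_cons IH// -scalerAr.
  have -> : 'X - x%:P = - x *: (1 - x^-1 *: 'X).
    rewrite scalerBr scalerA mulNr mulfV ?gt_eqF// scaleN1r opprK addrC.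
    by rewrite scaleNr -mul_polyC mulr1.
  by rewrite -scalerAl scalerA mulrC.
rewrite laguerre_multZ; apply: posrootedZ.
  rewrite mulf_neq0 ?lead_coef_eq0//.
  rewrite prodf_seq_neq0; apply: sub_all ps => x x0 /=; rewrite oppr_eq0 gt_eqF//.
apply: posrooted_laguerre_prod => //; rewrite all_map.
by apply: sub_all ps => x /=; rewrite invr_gt0.
Qed.

(** Each root x > 0 of [Q] gives the two roots i sqrt x and - i sqrt x. These are distinct and as
    many as the degree, so there is no other root and all are simple. *)
Lemma posrooted_conservative Q : posrooted Q ->
  let PC : {poly R[i]} := map_poly (real_complex R) (Q \Po (- 'X^2)) in
  forall z : R[i], root PC z -> complex.Re z = 0 /\ mup z PC = 1%N.
Proof.
move=> [Q0 [s [us ps rs szs]]] PC.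
have sQ : size Q = (size s).+1 by apply/eqP; rewrite eqn_leq szs max_poly_roots.
pose f x : R[i] := Complex 0 (Num.sqrt x); pose g x : R[i] := Complex 0 (- Num.sqrt x).
pose t := [seq f x | x <- s] ++ [seq g x | x <- s].
have sq_inj : {in s &, injective (@Num.sqrt R)}.
  move=> x y /(allP ps) x0 /(allP ps) y0 /eqP; rewrite eqr_sqrt ?ltW// => /eqP//.
have ut : uniq t.
  rewrite cat_uniq; apply/and3P; split.
  - by rewrite map_inj_in_uniq// => x y xs ys [] /sq_inj; apply.
  - apply/hasPn => _ /mapP[x /(allP ps) x0 ->]; apply/negP => /mapP[y /(allP ps) y0 [] /eqP].
    by rewrite lt_eqF// (@lt_trans _ _ 0)// ?oppr_lt0 sqrtr_gt0.
  - by rewrite map_inj_in_uniq// => x y xs ys [] /oppr_inj /sq_inj; apply.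
have rt : all (root PC) t.
  have aux x y : x \in s -> y ^+ 2 = x -> root PC (Complex 0 y).
    move=> xs yx; apply/rootP; rewrite /PC map_comp_poly horner_comp rmorphN rmorphXn /= map_polyX.
    rewrite hornerN hornerXn.
    have -> : - (Complex 0 y) ^+ 2 = real_complex R x.
      apply/eqP; rewrite eq_complex -yx !expr2 /=.
      by apply/andP; split; apply/eqP; ring.
    by rewrite horner_map /= (rootP (allP rs x xs)) rmorph0.
  rewrite all_cat; apply/andP; split; apply/allP => _ /mapP[x xs ->]; apply: (aux x) => //.
    by rewrite sqr_sqrtr// ltW// (allP ps).
  by rewrite sqrrN sqr_sqrtr// ltW// (allP ps).
have sPC : size PC = (size t).+1.
  have cQ : Q \Po (- 'X^2) != 0.
    apply/eqP => cQ0; have := size_comp_poly Q (- 'X^2).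
    rewrite cQ0 size_poly0 sQ size_polyN size_polyXn /= muln2 => /esym/eqP.
    rewrite double_eq0 => /eqP s0; move: sQ; rewrite s0 => /eqP/size_poly1P[c c0 Qc].
    by move: cQ0; rewrite Qc comp_polyC => /eqP; rewrite polyC_eq0 (negPf c0).
  rewrite size_map_poly -(prednK (n := size (Q \Po _))); last first.
    by rewrite lt0n size_poly_eq0.
  rewrite size_comp_poly sQ size_polyN size_polyXn /= size_cat !size_map; lia.
have PCE : PC = lead_coef PC *: \prod_(x <- t) ('X - x%:P).
  by apply: all_roots_prod_XsubC => //; rewrite uniq_rootsE.
have PC0 : lead_coef PC != 0 by rewrite lead_coef_eq0 -size_poly_eq0 sPC.
move=> z; rewrite {1}PCE rootZ// root_prod_XsubC => zt; split.
  by move: zt; rewrite mem_cat => /orP[] /mapP[x _ ->].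
rewrite PCE -mul_polyC mupMr; last by rewrite rootC.
by rewrite mu_prod_XsubC count_uniq_mem// zt.
Qed.

End more_posrooted.

(** * Real and imaginary parts of (1 + i t)^n *)

Section trig.
Variable R : realType.
Implicit Types (Q D : {poly R}) (n d l k : nat) (x y t : R).

(* At v = t^2, [cosp n] is Re (1 + i t)^n and t times [sinp n] is Im (1 + i t)^n. *)
Definition cosp n : {poly R} := \poly_(l < n.+1) ((-1) ^+ l * 'C(n, l.*2)%:R).
Definition sinp n : {poly R} := \poly_(l < n.+1) ((-1) ^+ l * 'C(n, l.*2.+1)%:R).

Lemma coef_cosp n l : (cosp n)`_l = (-1) ^+ l * 'C(n, l.*2)%:R.
Proof.
rewrite coef_poly; case: ltnP => // nl; rewrite bin_small ?mulr0//.
by rewrite -addnn (leq_trans nl) ?leq_addr.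
Qed.

Lemma coef_sinp n l : (sinp n)`_l = (-1) ^+ l * 'C(n, l.*2.+1)%:R.
Proof.
rewrite coef_poly; case: ltnP => // nl; rewrite bin_small ?mulr0//.
by rewrite ltnS -addnn (leq_trans (ltnW nl)) ?leq_addr.
Qed.

Lemma size_cosp n : (size (cosp n) <= n./2.+1)%N.
Proof. by apply/leq_sizeP => l nl; rewrite coef_cosp bin_small ?mulr0//; lia. Qed.

Lemma size_sinp n : (size (sinp n) <= n.-1./2.+1)%N.
Proof. by apply/leq_sizeP => l nl; rewrite coef_sinp bin_small ?mulr0//; lia. Qed.

Lemma cospS n : cosp n.+1 = cosp n - 'X * sinp n.
Proof.
apply/polyP => -[|l]; rewrite coefB coefXM !coef_cosp /= ?bin0 ?subr0//.
by rewrite coef_sinp doubleS binS natrD exprS; ring.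
Qed.

Lemma sinpS n : sinp n.+1 = sinp n + cosp n.
Proof. by apply/polyP => l; rewrite coefD !coef_sinp coef_cosp binS natrD; ring. Qed.

(** De Moivre for 1 + i tan x = (cos x + i sin x) / cos x; [cospS] and [sinpS] are the real and
    imaginary parts of a multiplication by 1 + i t. *)
Lemma moivre n x : cos x != 0 ->
  cos x ^+ n * (cosp n).[tan x ^+ 2] = cos (n%:R * x) /\
  cos x ^+ n * (tan x * (sinp n).[tan x ^+ 2]) = sin (n%:R * x).
Proof.
move=> c0; have sE : sin x = cos x * tan x by rewrite /tan mulrCA mulfV ?mulr1.
elim: n => [|n [IHc IHs]].
  rewrite mul0r cos0 sin0 !expr0 !mul1r.
  have -> : cosp 0 = 1 by apply/polyP => -[|[|l]]; rewrite coef_cosp coef1 ?mulr1 ?mulr0.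
  have -> : sinp 0 = 0 by apply/polyP => l; rewrite coef_sinp bin0n coef0 mulr0.
  by rewrite hornerC horner0 mulr0.
have -> : n.+1%:R * x = n%:R * x + x by rewrite -natr1 mulrDl mul1r.
rewrite cosD sinD -IHc -IHs sE cospS sinpS hornerD hornerN hornerM hornerX hornerD exprS.
by split; ring.
Qed.

Lemma tan_ge0 x : 0 <= x < pi / 2 -> 0 <= tan x.
Proof.
move=> /andP[x0 xp]; have [->|xn] := eqVneq x 0; first by rewrite tan0.
have pi0 := @pi_gt0 R.
have c0 : 0 < cos x by apply: cos_gt0_pihalf; rewrite xp andbT; lra.
rewrite /tan divr_ge0 ?ltW// sin_gt0_pihalf// xp andbT lt_neqAle eq_sym xn //.
Qed.

Lemma tan_sq_lt x y : 0 <= x -> x < y -> y < pi / 2 -> tan x ^+ 2 < tan y ^+ 2.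
Proof.
move=> x0 xy yp; have pi0 := @pi_gt0 R.
have h : tan x < tan y by rewrite ltr_tan// in_itv /=; lra.
have := @tan_ge0 x; rewrite x0 (lt_trans xy yp) => /(_ isT) tx.
by rewrite ltr_pXn2r// nnegrE (le_trans tx)// ltW.
Qed.

(** Only the last angle may reach pi / 2, where tan is infinite; the sign of the leading coefficient
    then stands for the evaluation. In the uses below this happens exactly for even n, so that both
    parities are treated at once. *)
Lemma tan_nodes_posrooted Q d (u : nat -> R) :
  (size Q <= d.+1)%N -> 0 <= u 0%N ->
  (forall k, (k < d)%N -> u k < u k.+1) -> (forall k, (k < d)%N -> u k < pi / 2) ->
  (forall k, (k <= d)%N -> u k < pi / 2 -> 0 < (-1) ^+ k * Q.[tan (u k) ^+ 2]) ->
  0 < (-1) ^+ d * Q`_d -> posrooted Q.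
Proof.
move=> sQ u0 iu up sgn lQ.
have szQ : size Q = d.+1.
  apply/eqP; rewrite eqn_leq sQ ltnNge; apply/negP => /leq_sizeP/(_ d (leqnn _)) Qd.
  by rewrite Qd mulr0 ltxx in lQ.
have uge0 k : (k <= d)%N -> 0 <= u k.
  elim: k => // k IH kd; apply: le_trans (IH (ltnW kd)) (ltW (iu _ kd)).
have inc k : (k < d)%N -> u k.+1 < pi / 2 -> tan (u k) ^+ 2 < tan (u k.+1) ^+ 2.
  by move=> kd; apply: tan_sq_lt; [apply/uge0/ltnW|exact: iu].
have [ud|ud] := ltP (u d) (pi / 2).
  apply: (@alternating_posrooted _ _ (fun k => tan (u k) ^+ 2) d) => //.
  - move=> k kd; apply: sgn => //; move: kd; rewrite leq_eqVlt => /predU1P[->//|].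
    exact: up.
  - move=> k kd; apply: inc => //; move: kd; rewrite leq_eqVlt => /predU1P[->//|].
    exact: up.
  - exact: sqr_ge0.
case: d => [|d] in sQ lQ iu up sgn szQ uge0 inc ud *.
  split; first by rewrite -size_poly_eq0 szQ.
  by exists [::]; rewrite szQ.
apply: (@alternating_lead_posrooted _ _ (fun k => tan (u k) ^+ 2) d) => //.
- by rewrite lead_coefE szQ.
- by move=> k kd; apply: sgn; [exact: leqW|exact: up].
- by move=> k kd; apply: inc; [exact: leqW|exact: up].
- exact: sqr_ge0.
Qed.

Lemma cos_natpi k : cos (k%:R * pi : R) = (-1) ^+ k.
Proof.
elim: k => [|k IH]; first by rewrite mul0r cos0.
by rewrite -natr1 mulrDl mul1r cosDpi IH exprS mulN1r.
Qed.

Lemma sin_natpi k : sin (k%:R * pi : R) = 0.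
Proof.
elim: k => [|k IH]; first by rewrite mul0r sin0.
by rewrite -natr1 mulrDl mul1r sinDpi IH oppr0.
Qed.

Lemma sin_halfpi k : sin ((k%:R + 2^-1) * pi : R) = (-1) ^+ k.
Proof. by rewrite mulrDl mulrC [2^-1 * _]mulrC sinDpihalf mulrC cos_natpi. Qed.


Lemma cos_gt0_quadrant x : 0 <= x < pi / 2 -> 0 < cos x.
Proof. by have := @pi_gt0 R => p0 h; apply: cos_gt0_pihalf; lra. Qed.

(** At v = tan^2 x the sign is that of cos (n x), which is (-1)^k at x = k pi / n. For
    [posrooted_sinp] it is that of sin ((n + 1) x), with x = (k + 1/2) pi / (n + 1). *)
Lemma posrooted_cosp n : posrooted (cosp n).
Proof.
have p0 := @pi_gt0 R.
have [->|n0] := posnP n.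
  have -> : cosp 0 = 1 by apply/polyP => -[|[|l]]; rewrite coef_cosp coef1 ?mulr1 ?mulr0.
  by split; [exact: oner_neq0|exists [::]; split => //; rewrite size_poly1].
have n0' : (0 : R) < n%:R by rewrite ltr0n.
apply: (@tan_nodes_posrooted _ n./2 (fun k => k%:R * pi / n%:R)).
- exact: size_cosp.
- by rewrite !mul0r.
- by move=> k _; rewrite ltr_pM2r ?invr_gt0// ltr_pM2r// ltr_nat.
- move=> k kn; rewrite ltr_pdivrMr// mulrC -mulrA ltr_pM2l//.
  rewrite mulrC ltr_pdivlMr// -natrM ltr_nat; lia.
- move=> k kn ku.
  have u0 : 0 <= k%:R * pi / n%:R :> R by rewrite divr_ge0// mulr_ge0// ltW.
  set x := (X in tan X) in ku u0 *.
  have c0 : 0 < cos x by apply: cos_gt0_quadrant; rewrite u0.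
  have [+ _] := @moivre n _ (lt0r_neq0 c0).
  have -> : n%:R * x = k%:R * pi by rewrite /x mulrC divfK ?gt_eqF.
  rewrite cos_natpi => h.
  rewrite -(@pmulr_lgt0 _ (cos x ^+ n)) ?exprn_gt0//.
  by rewrite -mulrA [X in _ * X]mulrC h -expr2 sqrr_sign.
- rewrite coef_cosp mulrA -expr2 sqrr_sign mul1r ltr0n bin_gt0; lia.
Qed.

Lemma posrooted_sinp n : posrooted (sinp n.+1).
Proof.
have p0 := @pi_gt0 R.
have n0' : (0 : R) < n.+1%:R by rewrite ltr0n.
apply: (@tan_nodes_posrooted _ n./2 (fun k => (k%:R + 2^-1) * pi / n.+1%:R)).
- exact: (size_sinp n.+1).
- by rewrite add0r divr_ge0// mulr_ge0// ltW.
- by move=> k _; rewrite ltr_pM2r ?invr_gt0// ltr_pM2r// ltrD2r ltr_nat.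
- move=> k kn; rewrite ltr_pdivrMr// mulrC -mulrA ltr_pM2l//.
  rewrite mulrC ltr_pdivlMr// mulrDl mulVf// -natrM natr1 ltr_nat; lia.
- move=> k kn ku.
  have u0 : 0 < (k%:R + 2^-1) * pi / n.+1%:R :> R.
    by rewrite divr_gt0// mulr_gt0// ltr_wpDl.
  set x := (X in tan X) in ku u0 *.
  have c0 : 0 < cos x by apply: cos_gt0_quadrant; rewrite ltW.
  have t0 : 0 < tan x by rewrite divr_gt0// sin_gt0_pihalf// u0.
  have [_] := @moivre n.+1 _ (lt0r_neq0 c0).
  have -> : n.+1%:R * x = (k%:R + 2^-1) * pi by rewrite /x mulrC divfK ?gt_eqF.
  rewrite sin_halfpi => h.
  have ct : 0 < cos x ^+ n.+1 * tan x by rewrite mulr_gt0// exprn_gt0.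
  rewrite -(pmulr_lgt0 _ ct).
  by rewrite -mulrA [X in _ * X]mulrC -mulrA h -expr2 sqrr_sign.
- rewrite coef_sinp mulrA -expr2 sqrr_sign mul1r ltr0n bin_gt0; lia.
Qed.

End trig.

(** * Polynomials of the squeezed ball *)

Section squeezed_ball_poly.
Variable R : realType.
Implicit Types (Q D h : {poly R}) (n d l k : nat) (a x y t : R).

(** The case r = 0 of [posrooted_step]: v^a times the image for [a] is proportional to the
    derivative of v^(a+1) times the image for a + 1. *)
Lemma posrooted_laguerre_pred a h : -1 < a ->
  posrooted (laguerre_mult (a + 1) h) -> posrooted (laguerre_mult a h).
Proof.
move=> a1; have a1p : 0 < a + 1 by rewrite -ltrBlDr sub0r.
have a1' : -1 < a + 1 by apply: lt_trans a1p; rewrite oppr_lt0.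
set G := laguerre_mult (a + 1) h => /(posrooted_step a1p (lexx 0)).
rewrite scale0r subr0 mul_polyC => pH.
suff -> : laguerre_mult a h = (a + 1)^-1 *: ('X * G^`() + (a + 1) *: G).
  by apply: posrootedZ; rewrite // invr_eq0 gt_eqF.
apply/polyP => l; rewrite coefZ coefD coefXM coefZ !coef_laguerre_mult.
case: l => [|l] /=; first by rewrite /rising !big_ord0 !divr1 add0r mulKf// gt_eqF.
have r1 := rising_gt0 l a1'.
rewrite rising_recl coef_deriv coef_laguerre_mult risingS.
have e : a + 1 + l.+1%:R != 0 by rewrite gt_eqF// addr_gt0// ltr0n.
have n1 := lt0r_neq0 r1; have n2 := lt0r_neq0 a1p.
move: e; rewrite -natr1 => e.
by field; rewrite ?n1 ?n2 ?e.
Qed.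

(** Up to a positive factor and a rescaling, the polynomial of infinite index of the squeezed ball
    ([weylQ_squeezed_ball]). *)
Definition cosfactp n : {poly R} :=
  \poly_(l < n.+1) ((-1) ^+ l * 'C(n, l.*2)%:R * l`!%:R).

Lemma coef_cosfactp n l : (cosfactp n)`_l = (-1) ^+ l * 'C(n, l.*2)%:R * l`!%:R.
Proof.
rewrite coef_poly; case: ltnP => // nl; rewrite bin_small ?mulr0 ?mul0r//; lia.
Qed.

Lemma size_laguerre_cosfactp a n : (size (laguerre_mult a (cosfactp n)) <= n./2.+1)%N.
Proof.
apply/leq_sizeP => l nl; rewrite coef_laguerre_mult coef_cosfactp bin_small; first by rewrite mulr0 !mul0r.
lia.
Qed.

(** The integral of (1 - x^2)^l over [0, 1]; [antiderivative_pow] expresses this by polynomials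
    alone. *)
Let b l : R := l`!%:R / rising 2^-1 l.

Let N21 : -1 < 2^-1 :> R. Proof. lra. Qed.

Let bS l : b l.+1 = b l * ((l.*2.+2)%:R / (l.*2.+3)%:R).
Proof.
rewrite /b factS natrM risingS -[(l.*2.+3)%:R]natr1 -[(l.*2.+2)%:R]natr1.
rewrite -[(l.*2.+1)%:R]natr1 -[l.+1%:R]natr1 -muln2 natrM.
have r1 := lt0r_neq0 (rising_gt0 l N21).
have l0 : (0 : R) <= l%:R := ler0n _ _.
by field; rewrite r1 andbT; apply: lt0r_neq0; lra.
Qed.

Lemma antiderivative_pow l : exists p : {poly R},
  [/\ p^`() = - (1 - 'X^2) ^+ l, p.[1] = 0 & p.[0] = b l].
Proof.
elim: l => [|l [p [dp p1 p0]]].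
  exists (1 - 'X); rewrite derivB derivX derivC sub0r expr0; split => //.
    by rewrite !hornerE subrr.
  by rewrite !hornerE subr0 /b /rising big_ord0 fact0 divr1.
have l1 : (l.*2.+3)%:R != 0 :> R by rewrite pnatr_eq0.
(* Integration by parts: the derivative of x (1 - x^2)^(l+1) is (2l + 3) (1 - x^2)^(l+1) - (2l + 2)
   (1 - x^2)^l. *)
exists ((l.*2.+3)%:R^-1 *: ((l.*2.+2)%:R *: p - 'X * (1 - 'X^2) ^+ l.+1)); split.
- rewrite derivZ derivB !derivZ dp derivM derivX deriv_exp derivB derivC derivXn /=.
  rewrite -(scalerK l1 (- (1 - 'X^2) ^+ l.+1)); congr (_ *: _).
  rewrite -!mul_polyC !polyC_natr expr1 sub0r mul1r [(1 - 'X^2) ^+ l.+1]exprS.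
  rewrite -[_ *+ l.+1]mulr_natr -['X *+ 2]mulr_natr; set q := (1 - 'X^2) ^+ l.
  have -> : (l.*2.+3)%:R = l%:R * 2%:R + 3%:R :> {poly R} by rewrite -natrM muln2 -natrD addn3.
  have -> : (l.*2.+2)%:R = l%:R * 2%:R + 2%:R :> {poly R} by rewrite -natrM muln2 -natrD addn2.
  by rewrite -[l.+1%:R]natr1; ring.
- rewrite hornerZ hornerD hornerN !hornerZ p1 hornerM horner_exp hornerD hornerN.
  by rewrite hornerXn hornerC expr1n subrr expr0n /= !mulr0 subrr mulr0.
- rewrite hornerZ hornerD hornerN !hornerZ p0 hornerM hornerX mul0r bS.
  by rewrite subr0; field.
Qed.

(** Since (n + 1) C(n, 2l) = (2l + 1) C(n + 1, 2l + 1), the polynomial for p = 1 is, up to the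
    factor n + 1, [sinp n.+1] with its l-th coefficient multiplied by [mu l]. *)
Let mu l : R := (l.*2.+1)%:R * b l.

Let muS l : mu l.+1 = mu l + b l.
Proof.
rewrite /mu doubleS bS mulrCA [X in _ * X]mulrC divfK ?pnatr_eq0//.
by rewrite -[(l.*2.+2)%:R]natr1; ring.
Qed.

(** By [muS], mu l - 1 is the sum of the b k for k < l, hence the integral over [0, 1] of the
    geometric sum (1 - (1 - x^2)^l) / x^2, which is - q'. *)
Lemma antiderivative_geom l : exists q : {poly R},
  [/\ 'X^2 * q^`() = (1 - 'X^2) ^+ l - 1, q.[1] = 0 & q.[0] = mu l - 1].
Proof.
elim: l => [|l [q [dq q1 q0]]].
  exists 0; rewrite deriv0 mulr0 expr0 subrr !horner0; split => //.
  by rewrite /mu /b /rising big_ord0 fact0 divr1 mulr1 subrr.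
have [p [dp p1 p0]] := antiderivative_pow l.
exists (q + p); rewrite derivD mulrDr dq dp !hornerD q1 p1 q0 p0 muS addr0 [(1 - 'X^2) ^+ l.+1]exprS.
by split => //; ring.
Qed.

(* The sum is the integral over [0, pi/2] of (D(1) - s D(s^2)) / cos^2 x dx,
   where s = sin x; [F] is an explicit antiderivative of the integrand. *)
Lemma moment_gt0 D : (forall s, 0 <= s < 1 -> s * D.[s ^+ 2] < D.[1]) ->
  0 < \sum_(l < size D) D`_l * mu l.
Proof.
move=> Ds; have /choice[q qP] := antiderivative_geom.
pose P := \sum_(l < size D) D`_l *: q l.
have P1 : P.[1] = 0.
  by rewrite /P horner_sum big1// => i _; rewrite hornerZ; have [_ -> _] := qP i; rewrite mulr0.
have P0 : P.[0] = \sum_(l < size D) D`_l * mu l - D.[1].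
  rewrite (horner_coef D) -sumrB /P horner_sum; apply: eq_bigr => i _.
  by rewrite hornerZ; have [_ _ ->] := qP i; rewrite expr1n mulrBr.
have dP x : x ^+ 2 * P^`().[x] = D.[1 - x ^+ 2] - D.[1].
  rewrite !(horner_coef D) -sumrB /P (raddf_sum (@deriv R)) /= horner_sum mulr_sumr; apply: eq_bigr => i _.
  rewrite derivZ hornerZ mulrCA; have [/(congr1 (fun r => r.[x])) + _ _] := qP i.
  rewrite hornerM hornerXn => ->; rewrite hornerD hornerN hornerC horner_exp.
  by rewrite hornerD hornerN hornerC hornerXn expr1n mulrBr.
(* Write D(1) - s D(s^2) as D(1) (1 - s) + s (D(1) - D(s^2)) and divide by cos^2 x = 1 - s^2: the
   first part becomes D(1) / (1 + sin x), the second - sin x P'(cos x), and both have the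
   antiderivatives used here. The mean value theorem then takes the place of integration. *)
pose F x := D.[1] * (1 - cos x / (1 + sin x)) + P.[cos x].
pose dF x := D.[1] / (1 + sin x) - sin x * P^`().[cos x].
have p0 := @pi_gt0 R.
have s0 x : 0 <= x <= pi / 2 -> 0 <= sin x by move=> h; apply: sin_ge0_pi; lra.
have dFP x : 0 <= x <= pi / 2 -> is_derive x 1 F (dF x).
  move=> xp; have s1 : 1 + sin x != 0 by apply: lt0r_neq0; have := s0 _ xp; lra.
  have h1 := is_deriveD (is_derive_cst (1 : R) x (1 : R)) (is_derive_sin x).
  have h2 := @is_deriveV _ (cst 1 + @sin R) x _ _ s1 h1.
  have h3 := is_deriveM (is_derive_cos x) h2.
  have h4 := is_deriveZ D.[1] (is_deriveB (is_derive_cst (1 : R) x 1) h3).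
  have h5 := is_derive1_comp (is_derive_poly P (cos x)) (is_derive_cos x).
  have h6 := is_deriveD h4 h5.
  suff e : dF x = (D.[1] *:
       (0 - (cos x *: (- (1 + sin x) ^- 2 *: (0 + cos x)) + (1 + sin x)^-1 *: - sin x)) +
       P^`().[cos x] * - sin x).
    rewrite e.
  exact: h6.
  rewrite /dF /GRing.scale /=.
  have c2 : cos x * cos x = (1 + sin x) * (1 - sin x).
    by rewrite -expr2 -[cos x ^+ 2](addrK (sin x ^+ 2)) cos2Dsin2; ring.
  transitivity (D.[1] * ((cos x * cos x) / (1 + sin x) ^+ 2 + sin x / (1 + sin x)) -
      sin x * P^`().[cos x]).
    by rewrite c2; field.
  by field.
have cF : {within `[0, pi / 2], continuous F}.
  apply: derivable_within_continuous => x; rewrite in_itv /= => /dFP dx.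
  exact: ex_derive.
have [||c cP FE] := @MVT R F dF 0 (pi / 2) _ _ cF.
- by rewrite divr_gt0.
- move=> x; rewrite in_itv /= => /andP[x0 xp]; apply: dFP; apply/andP; split; exact: ltW.
move: cP; rewrite in_itv /= => /andP[c0 cp].
have F0 : F 0 = 0 by rewrite /F cos0 sin0 P1 !addr0 divr1 subrr mulr0.
have Fp : F (pi / 2) = \sum_(l < size D) D`_l * mu l.
  by rewrite /F cos_pihalf mul0r subr0 mulr1 P0 addrC subrK.
have sc : 0 <= sin c by apply: s0; rewrite !ltW.
have cc : 0 < cos c by apply: cos_gt0_pihalf; rewrite cp andbT; lra.
have c2 := cos2Dsin2 c.
have s1 : sin c < 1.
  have : 0 < cos c ^+ 2 by rewrite exprn_gt0.
  have : 0 <= sin c ^+ 2 by rewrite sqr_ge0.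
  nra.
have -> : \sum_(l < size D) D`_l * mu l = dF c * (pi / 2) by move: FE; rewrite F0 Fp !subr0.
rewrite mulr_gt0 ?divr_gt0//.
have dc : cos c ^+ 2 * dF c = D.[1] - sin c * D.[sin c ^+ 2].
  have e : 1 - cos c ^+ 2 = sin c ^+ 2 by rewrite -c2; ring.
  rewrite /dF mulrBr [cos c ^+ 2 * (sin c * _)]mulrCA dP e.
  have -> : cos c ^+ 2 = (1 + sin c) * (1 - sin c).
    by rewrite -[cos c ^+ 2](addrK (sin c ^+ 2)) c2; ring.
  by field; apply: lt0r_neq0; lra.
rewrite -(pmulr_rgt0 _ (exprn_gt0 2 cc)) dc subr_gt0; apply: Ds.
by rewrite sc s1.
Qed.

Lemma rising2 l : rising (2 : R) l = l.+2`!%:R / 2.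
Proof.
elim: l => [|l IH]; first by rewrite /rising big_ord0 divff.
by rewrite risingS IH [in RHS]factS natrM -natrD addnC addn2; ring.
Qed.

(** The left-hand side is |Im (1 + i tan x)^(n+1)|, at most the modulus (cos x)^-(n+1), which
    increases with x. *)
Lemma norm_sinp_lt n x y : 0 <= x -> x < y -> y < pi / 2 ->
  `|tan x * (sinp R n.+1).[tan x ^+ 2]| < (cos y ^+ n.+1)^-1.
Proof.
move=> x0 xy yp; have xp := lt_trans xy yp.
have p0 := @pi_gt0 R.
have cx : 0 < cos x by apply: cos_gt0_quadrant; rewrite x0.
have cy : 0 < cos y by apply: cos_gt0_quadrant; rewrite yp andbT ltW// (le_lt_trans x0).
have cxy : cos y < cos x by rewrite ltr_cos// in_itv /=; lra.
have [_ h] := @moivre R n.+1 x (lt0r_neq0 cx).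
have -> : tan x * (sinp R n.+1).[tan x ^+ 2] = sin (n.+1%:R * x) / cos x ^+ n.+1.
  by rewrite -h [RHS]mulrC mulKf// expf_neq0// gt_eqF.
rewrite normrM normfV [`|cos x ^+ _|]ger0_norm ?exprn_ge0 ?ltW//.
apply: (@le_lt_trans _ _ ((cos x ^+ n.+1)^-1)).
  apply: ler_piMl; first by rewrite invr_ge0 exprn_ge0// ltW.
  by rewrite ler_norml sin_geN1 sin_le1.
by rewrite ltf_pV2 ?posrE ?exprn_gt0// ltr_pXn2r// nnegrE ltW.
Qed.

Lemma coef_comp_scaleX Q (c : R) l : (Q \Po (c *: 'X))`_l = c ^+ l * Q`_l.
Proof.
have -> : Q \Po (c *: 'X) = \poly_(i < size Q) (c ^+ i * Q`_i).
  rewrite comp_polyE poly_def; apply: eq_bigr => i _.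
  by rewrite exprZn scalerA mulrC.
by rewrite coef_poly; case: ltnP => // /leq_sizeP ->//; rewrite mulr0.
Qed.

(** At the nodes x of [posrooted_sinp], Im (1 + i tan x)^(n+1) is (-1)^k times the full modulus (cos
    x)^-(n+1). For D(v) = (-1)^k sinp(tan^2 x v), the value wanted is a positive multiple of the sum
    in [moment_gt0]. The hypothesis there, multiplied by tan x, compares the imaginary part at the
    smaller t = s tan x = tan y with this modulus, which is [norm_sinp_lt]. *)
Lemma posrooted_cosfactp1 n : posrooted (laguerre_mult 2^-1 (cosfactp n)).
Proof.
have p0 := @pi_gt0 R.
have n0' : (0 : R) < n.+1%:R by rewrite ltr0n.
set Q := laguerre_mult _ _.
apply: (@tan_nodes_posrooted _ _ n./2 (fun k => (k%:R + 2^-1) * pi / n.+1%:R)).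
- exact: size_laguerre_cosfactp.
- by rewrite add0r divr_ge0// mulr_ge0// ltW.
- by move=> k _; rewrite ltr_pM2r ?invr_gt0// ltr_pM2r// ltrD2r ltr_nat.
- move=> k kn; rewrite ltr_pdivrMr// mulrC -mulrA ltr_pM2l//.
  rewrite mulrC ltr_pdivlMr// mulrDl mulVf// -natrM natr1 ltr_nat; lia.
- move=> k kn ku.
  have u0 : 0 < (k%:R + 2^-1) * pi / n.+1%:R :> R.
    by rewrite divr_gt0// mulr_gt0// ltr_wpDl.
  set x := (X in tan X) in ku u0 *.
  have c0 : 0 < cos x by apply: cos_gt0_quadrant; rewrite ltW.
  have t0 : 0 < tan x by rewrite divr_gt0// sin_gt0_pihalf// u0.
  have [_] := @moivre R n.+1 _ (lt0r_neq0 c0).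
  have -> : n.+1%:R * x = (k%:R + 2^-1) * pi by rewrite /x mulrC divfK ?gt_eqF.
  rewrite sin_halfpi => h.
  pose D := (-1) ^+ k *: (sinp R n.+1 \Po (tan x ^+ 2 *: 'X)).
  have coefD l : D`_l = (-1) ^+ k * (tan x ^+ 2) ^+ l * (sinp R n.+1)`_l.
    by rewrite /D coefZ coef_comp_scaleX mulrA.
  have DE s : D.[s] = (-1) ^+ k * (sinp R n.+1).[tan x ^+ 2 * s].
    by rewrite /D hornerZ horner_comp hornerZ hornerX.
  have sD : (size D <= n./2.+1)%N.
    by apply/leq_sizeP => l ln; rewrite coefD (leq_sizeP _ _ (size_sinp R n.+1))// mulr0.
  have QE : n.+1%:R * ((-1) ^+ k * Q.[tan x ^+ 2]) = \sum_(l < size D) D`_l * mu l.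
    rewrite (big_ord_widen n./2.+1 (fun l => D`_l * mu l) sD) [RHS]big_mkcond /=.
    rewrite (horner_coef_wide _ (size_laguerre_cosfactp _ _)) mulr_sumr mulr_sumr.
    apply: eq_bigr => l _; case: ifPn; last first.
      rewrite -leqNgt => /leq_sizeP/(_ l (leqnn _)) Dl0.
      have nz : (-1) ^+ k * (tan x ^+ 2) ^+ l != 0.
        by rewrite mulf_neq0 ?signr_eq0// !expf_neq0// gt_eqF.
      move: (coefD l); rewrite Dl0 => /esym/eqP; rewrite mulf_eq0 (negPf nz) /=.
      rewrite coef_sinp mulf_eq0 signr_eq0 pnatr_eq0 /=.
      move=> /eqP b0; rewrite /Q coef_laguerre_mult coef_cosfactp.
      have : (n.+1 * 'C(n, l.*2) = 0)%N by rewrite mul_bin_diag b0 muln0.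
      by move=> /eqP; rewrite muln_eq0 /= => /eqP ->; rewrite mulr0 !mul0r !mulr0.
    move=> _; rewrite coefD coef_sinp /Q coef_laguerre_mult coef_cosfactp /mu /b.
    have : n.+1%:R * 'C(n, l.*2)%:R = (l.*2.+1)%:R * 'C(n.+1, l.*2.+1)%:R :> R.
      by rewrite -!natrM mul_bin_diag.
    move=> e; transitivity ((-1) ^+ k * ((-1) ^+ l * (n.+1%:R * 'C(n, l.*2)%:R) *
      l`!%:R / rising 2^-1 l) * (tan x ^+ 2) ^+ l).
      by ring.
    by rewrite e; ring.
  have : 0 < n.+1%:R * ((-1) ^+ k * Q.[tan x ^+ 2]).
    rewrite QE; apply: moment_gt0 => s /andP[s0 s1].
    have D1 : tan x * D.[1] = (cos x ^+ n.+1)^-1.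
      rewrite DE mulr1 mulrCA.
      apply: (@mulfI _ (cos x ^+ n.+1)); first by rewrite expf_neq0// gt_eqF.
      by rewrite [LHS]mulrCA h -expr2 sqrr_sign divff// expf_neq0// gt_eqF.
    rewrite -(ltr_pM2l t0) D1.
    pose y := atan (tan x * s).
    have ty : tan y = tan x * s by rewrite /y atanK.
    have y0 : 0 <= y by rewrite -(@atan0 R) le_atan// mulr_ge0// ltW.
    have yx : y < x.
      rewrite -(@tanK _ x); last first.
        by rewrite in_itv /= ku andbT; apply: lt_trans u0; rewrite oppr_lt0 divr_gt0.
      by rewrite lt_atan// gtr_pMr.
    have := @norm_sinp_lt n _ _ y0 yx ku.
    rewrite DE -exprMn -ty; apply: le_lt_trans.
    rewrite !mulrA -ty.
    apply: le_trans (ler_norm _) _.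
    by rewrite [_ * (-1) ^+ k]mulrC -mulrA normrM normr_sign mul1r.
  by rewrite pmulr_rgt0.
- rewrite /Q coef_laguerre_mult coef_cosfactp !mulrA -expr2 sqrr_sign mul1r.
  rewrite divr_gt0 ?rising_gt0// -natrM ltr0n muln_gt0 fact_gt0 bin_gt0; lia.
Qed.

End squeezed_ball_poly.

(** * The squeezed ball at indices 4 and 2 *)

Section squeezed_ball_poly4.
Variable R : realType.
Implicit Types (Q D h : {poly R}) (n d l k m : nat) (a x y t : R).

Lemma coef_laguerre2_cosfactp n l : (laguerre_mult 2 (cosfactp R n))`_l =
  (-1) ^+ l * 'C(n, l.*2)%:R * (2 / ((l%:R + 1) * (l%:R + 2))).
Proof.
rewrite coef_laguerre_mult coef_cosfactp rising2.
have f0 : l`!%:R != 0 :> R by rewrite pnatr_eq0 -lt0n fact_gt0.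
have l0 : (0 : R) <= l%:R := ler0n _ _.
rewrite !factS !natrM -[l.+2%:R]natr1 -[l.+1%:R]natr1.
by field; apply/and3P; split => //; apply: lt0r_neq0; lra.
Qed.

(** With m = 2l + 4 the left-hand side is (m - 1) (m - 3) C(n + 4, m), because 2 / ((l + 1) (l + 2))
    = 8 / ((m - 2) m). The right-hand side is the same number on row n + 2; every binomial is
    reduced to C(n + 2, 2l + 2). *)
Lemma cosfactp4_bin n l : let N : R := n%:R in let L : R := l%:R in
  (N + 1) * (N + 2) * (N + 3) * (N + 4) / 8 * ('C(n, l.*2)%:R * (2 / ((L + 1) * (L + 2)))) =
  3 * 'C(n.+2, l.*2.+4)%:R - 3 * (N + 2) * 'C(n.+2, l.*2.+3)%:R +
    ((N + 2) ^+ 2 - 1) * 'C(n.+2, l.*2.+2)%:R.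
Proof.
move=> N L; have N0 : 0 <= N := ler0n _ _; have L0 : 0 <= L := ler0n _ _.
have natL j : (l.*2 + j)%:R = 2 * L + j%:R :> R by rewrite natrD -muln2 natrM mulrC.
have left k : k.+1%:R * 'C(n.+2, k.+1)%:R = ((N + 2) - k%:R) * 'C(n.+2, k)%:R :> R.
  rewrite -natrM mul_bin_left natrM; have [kn|nk] := leqP k n.+2.
    by rewrite natrB// -addn2 natrD.
  by rewrite bin_small ?mulr0.
have e1 : (2 * L + 2) * (2 * L + 1) * 'C(n.+2, l.*2.+2)%:R = (N + 2) * (N + 1) * 'C(n, l.*2)%:R :> R.
  have : (l.*2.+2 * (l.*2.+1 * 'C(n.+2, l.*2.+2)) = n.+2 * (n.+1 * 'C(n, l.*2)))%N.
    by rewrite mul_bin_diag mulnCA -mul_bin_diag mulnCA.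
  move=> /(congr1 (fun i => i%:R : R)); rewrite !natrM -(addn2 l.*2) -(addn1 l.*2) !natL.
  by rewrite -(addn2 n) -(addn1 n) !natrD !mulrA.
have e2 : (2 * L + 3) * 'C(n.+2, l.*2.+3)%:R = (N - 2 * L) * 'C(n.+2, l.*2.+2)%:R :> R.
  by have := left l.*2.+2; rewrite -{1}(addn3 l.*2) -{2}(addn2 l.*2) !natL => ->; ring.
have e3 : (2 * L + 4) * 'C(n.+2, l.*2.+4)%:R = (N - 2 * L - 1) * 'C(n.+2, l.*2.+3)%:R :> R.
  by have := left l.*2.+3; rewrite -{1}(addn4 l.*2) -{2}(addn3 l.*2) !natL => ->; ring.
set x := 'C(n, _)%:R in e1 *; set A := 'C(_, l.*2.+2)%:R in e1 e2 *.
set B := 'C(_, l.*2.+3)%:R in e2 e3 *; set E := 'C(_, l.*2.+4)%:R in e3 *.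
have h1 : 2 * L + 1 != 0 by apply: lt0r_neq0; lra.
have h2 : L + 2 != 0 by apply: lt0r_neq0; lra.
have h3 : 2 * L + 3 != 0 by apply: lt0r_neq0; lra.
have h4 : L + 1 != 0 by apply: lt0r_neq0; lra.
have h5 : N + 1 != 0 by apply: lt0r_neq0; lra.
have h6 : N + 2 != 0 by apply: lt0r_neq0; lra.
have xE : x = (2 * L + 2) * (2 * L + 1) * A / ((N + 2) * (N + 1)).
  by rewrite e1; field; rewrite h5 h6.
have BE : B = (N - 2 * L) * A / (2 * L + 3) by rewrite -e2; field.
have EE : E = (N - 2 * L - 1) * B / (2 * L + 4).
  by rewrite -e3; field; apply: lt0r_neq0; lra.
rewrite EE BE xE; field.
by rewrite h2 h3 h4 h5 h6 /= ?andbT; apply: lt0r_neq0; lra.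
Qed.

(* Without its last term, the right-hand side is (theta - 3)(theta - 1) applied to
   Re (1 + i t)^(n+4), where theta = t d/dt and 'X stands for t^2; the last term
   removes its coefficients of degree 0 and 1 in 'X. *)
Lemma cosfactp4E n : let N : R := n%:R in
  ((N + 1) * (N + 2) * (N + 3) * (N + 4) / 8) *: ('X^2 * laguerre_mult 2 (cosfactp R n)) =
  3%:P * cosp R n.+2 - ((N + 2) ^+ 2 - 1)%:P * ('X * cosp R n.+2) +
  (3 * (N + 2))%:P * ('X * sinp R n.+2) - (3%:P + ((N + 3) * (N + 4) / 2)%:P * 'X).
Proof.
move=> N; have n2 : n.+2%:R = N + 2 by rewrite -addn2 natrD.
apply/polyP => k.
rewrite coefZ coefXnM !(coefD, coefN) !coefCM !coefXM coefC coefX !coef_cosp !coef_sinp coef_laguerre2_cosfactp.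
case: k => [|[|l]] /=.
- by rewrite bin0; ring.
- have b2 : 2 * 'C(n.+2, 2)%:R = (N + 2) * (N + 1) :> R.
    by rewrite -natrM -mul_bin_diag bin1 natrM n2 -[n.+2.-1]/n.+1 -[n.+1%:R]natr1.
  rewrite -[1.*2]/2%N -[0.*2]/0%N bin0 bin1 n2.
  have -> : 'C(n.+2, 2)%:R = (N + 2) * (N + 1) / 2 :> R by rewrite -b2; field.
  by rewrite expr1 expr0; field.
- have := cosfactp4_bin n l; rewrite -/N => e; rewrite !doubleS subn2 /=.
  transitivity ((-1) ^+ l * ((N + 1) * (N + 2) * (N + 3) * (N + 4) / 8 *
      ('C(n, l.*2)%:R * (2 / ((l%:R + 1) * (l%:R + 2)))))); first by rewrite !mulrA; ring.
  by rewrite e !exprS; ring.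
Qed.

Lemma le_tan x : 0 <= x < pi / 2 -> x <= tan x.
Proof.
move=> /andP[x0 xp]; have [->|xn] := eqVneq x 0; first by rewrite tan0.
have p0 := @pi_gt0 R.
have xgt0 : 0 < x by rewrite lt_neqAle eq_sym xn.
have cy y : y \in `[0, x] -> 0 < cos y.
  by rewrite in_itv /= => /andP[y0 yx]; apply: cos_gt0_quadrant; rewrite y0 (le_lt_trans yx).
have cF : {within `[0, x], continuous (@tan R)}.
  apply: derivable_within_continuous => y /cy cy0.
  by apply: derivable_tan; rewrite gt_eqF.
have [|c cP] := @MVT R (@tan R) (fun y => (cos y) ^- 2) 0 x xgt0 _ cF.
  move=> y yP; apply: is_derive_tan; rewrite gt_eqF//; apply: cy.
  exact: subset_itv_oo_cc.
rewrite tan0 !subr0 => ->; rewrite ler_peMl//.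
have cc : 0 < cos c by apply: cy; exact: subset_itv_oo_cc.
rewrite invf_ge1 ?exprn_gt0// expr_le1// ?ltW//; exact: cos_le1.
Qed.

(** At angles j pi / (n + 2) the imaginary part of (1 + i t)^(n+2) vanishes and the real part is
    plus or minus its modulus [rho], so the closed form [cosfactp4E] has a dominant term of known
    sign. The angles are those with j >= 2, together with 0, where the factor v^2 of the closed form
    vanishes and the constant coefficient is read instead. The angle pi / (n + 2) is left out: the
    expected sign there is the one at 0. *)
Lemma posrooted_cosfactp4 n : posrooted (laguerre_mult 2 (cosfactp R n)).
Proof.
have p0 := @pi_gt0 R.
have n0' : (0 : R) < n.+2%:R by rewrite ltr0n.
set Q := laguerre_mult _ _.
apply: (@tan_nodes_posrooted _ _ n./2 (fun k => if k is j.+1 then j.+2%:R * pi / n.+2%:R else 0)).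
- exact: size_laguerre_cosfactp.
- by [].
- case=> [_|k _]; first by rewrite divr_gt0// mulr_gt0.
  by rewrite ltr_pM2r ?invr_gt0// ltr_pM2r// ltr_nat.
- case=> [_|k kn]; first by rewrite divr_gt0.
  rewrite ltr_pdivrMr// mulrC -mulrA ltr_pM2l//.
  rewrite mulrC ltr_pdivlMr// -natrM ltr_nat; lia.
- case=> [_ _|k kn ku].
    rewrite expr0 mul1r tan0 expr0n /= horner_coef0 /Q coef_laguerre2_cosfactp bin0.
    by rewrite expr0 !mul1r add0r divr_gt0// mulr_gt0.
  set x := (X in tan X) in ku *.
  have x0 : 0 <= x by rewrite divr_ge0// mulr_ge0// ltW.
  have c0 : 0 < cos x by apply: cos_gt0_quadrant; rewrite x0.
  have [] := @moivre R n.+2 _ (lt0r_neq0 c0).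
  have -> : n.+2%:R * x = k.+2%:R * pi by rewrite /x mulrC divfK ?gt_eqF.
  rewrite cos_natpi sin_natpi => hc hs.
  have xt : x <= tan x by apply: le_tan; rewrite x0.
  pose N : R := n%:R; pose K : R := k%:R.
  have NE : n.+2%:R = N + 2 by rewrite -addn2 natrD.
  have KE : k.+2%:R = K + 2 by rewrite -addn2 natrD.
  have N0 : 0 <= N := ler0n _ _. have K0 : 0 <= K := ler0n _ _.
  have kN : 2 * (K + 2) < N + 2.
    move: ku; rewrite /x ltr_pdivrMr// mulrC -mulrA ltr_pM2l// NE KE mulrC ltr_pdivlMr//.
    by rewrite mulrC.
  set v := tan x ^+ 2 in hc hs *.
  (* From (n + 2) tan x >= (n + 2) x = (k + 2) pi and pi >= 2. *)
  have v_ge : 4 * (K + 2) ^+ 2 <= (N + 2) ^+ 2 * v.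
    have px : 2 * (K + 2) <= (N + 2) * tan x.
      apply: (@le_trans _ _ ((N + 2) * x)); last by rewrite ler_pM2l// -NE.
      rewrite /x NE KE [X in _ <= X]mulrC divfK; last by rewrite -NE gt_eqF.
      by rewrite mulrC ler_pM2l ?pi_ge2// ltr_wpDl.
    rewrite /v -exprMn -(_ : (2 * (K + 2)) ^+ 2 = 4 * (K + 2) ^+ 2); last by ring.
    by rewrite ler_pXn2r// nnegrE; lra.
  pose rho := (cos x ^+ n.+2)^-1.
  have rho1 : 1 <= rho.
    by rewrite /rho invf_ge1 ?exprn_gt0// exprn_ile1 ?ltW ?cos_le1.
  have cE : (cosp R n.+2).[v] = (-1) ^+ k * rho.
    apply: (@mulfI _ (cos x ^+ n.+2)); first by rewrite expf_neq0// gt_eqF.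
    by rewrite hc mulrCA divff ?expf_neq0 ?gt_eqF// mulr1 !exprS !mulN1r opprK.
  have sE : v * (sinp R n.+2).[v] = 0.
    move/eqP: hs; rewrite mulf_eq0 expf_eq0 gt_eqF// andbF /= => /eqP h.
    by rewrite /v expr2 -mulrA -/v h mulr0.
  have := congr1 (fun p => p.[v]) (cosfactp4E n).
  rewrite -/N -/Q hornerZ hornerM hornerXn !(hornerD, hornerN) !hornerM !hornerC hornerX cE sE mulr0 addr0.
  set q := Q.[v] => qE.
  have : 0 < (N + 1) * (N + 2) * (N + 3) * (N + 4) / 8 * v ^+ 2 * ((-1) ^+ k.+1 * q).
    have -> : forall A B : R, A * B * ((-1) ^+ k.+1 * q) = (-1) ^+ k.+1 * (A * (B * q)) by move=> A B; ring.
    rewrite qE.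
    have Nv : 3 <= ((N + 2) ^+ 2 - 1) * v by nra.
    rewrite exprS mulN1r mulNr.
    have -> : - ((-1) ^+ k * (3 * ((-1) ^+ k * rho) - ((N + 2) ^+ 2 - 1) * (v * ((-1) ^+ k * rho)) -
      (3 + (N + 3) * (N + 4) / 2 * v))) = ((-1) ^+ k * (-1) ^+ k) * ((((N + 2) ^+ 2 - 1) * v - 3) * rho)
       + (-1) ^+ k * (3 + (N + 3) * (N + 4) / 2 * v) by ring.
    rewrite -expr2 sqrr_sign mul1r.
    have v0 : 0 <= v by rewrite sqr_ge0.
    set M := (X in X * rho); set T := (X in _ ^+ k * X).
    have T0 : 0 < T by rewrite /T; nra.
    have M0 : 0 <= M by rewrite subr_ge0.
    have Mr : M <= M * rho by rewrite ler_peMr.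
    (* For even k the correction [T] has the sign of the main term. For odd k it opposes it, but
       then k >= 1, whence N >= 5 and (N + 2)^2 v >= 36, which leaves enough room. *)
    have [ok|ok] := boolP (odd k); last first.
      by rewrite -signr_odd (negPf ok) expr0 mul1r; lra.
    rewrite -signr_odd ok expr1 mulN1r subr_gt0; apply: lt_le_trans Mr.
    have K1 : 1 <= K by rewrite ler1n; case: (k) ok.
    have N5 : 5 <= N.
      have : (3 * 2 < n.+2)%N.
        rewrite -(ltr_nat R) NE natrM; lra.
      by rewrite -ltnS !ltnS => h; rewrite (ler_nat _ 5).
    have v36 : 36 <= (N + 2) ^+ 2 * v by nra.
    rewrite -(ltr_pM2l (exprn_gt0 2 (_ : 0 < N + 2))); last by lra.
    have -> : (N + 2) ^+ 2 * M = ((N + 2) ^+ 2 - 1) * ((N + 2) ^+ 2 * v) - 3 * (N + 2) ^+ 2.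
      by rewrite /M; ring.
    have -> : (N + 2) ^+ 2 * T = 3 * (N + 2) ^+ 2 + (N + 3) * (N + 4) / 2 * ((N + 2) ^+ 2 * v).
      by rewrite /T; ring.
    set w := _ * v in v36 *.
    have a0 : 0 <= (N - 2) * (N + 3) by nra.
    have wa : 0 <= (w - 36) * ((N - 2) * (N + 3)) by rewrite mulr_ge0// subr_ge0.
    have h : (N + 2) ^+ 2 < 3 * ((N - 2) * (N + 3)) by nra.
    rewrite -subr_gt0.
    have -> : ((N + 2) ^+ 2 - 1) * w - 3 * (N + 2) ^+ 2 -
      (3 * (N + 2) ^+ 2 + (N + 3) * (N + 4) / 2 * w) =
      (w - 36) * ((N - 2) * (N + 3)) / 2 + 6 * (3 * ((N - 2) * (N + 3)) - (N + 2) ^+ 2) by field.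
    lra.
  have v0 : 0 < v.
    rewrite -(@pmulr_rgt0 _ ((N + 2) ^+ 2)); last by rewrite exprn_gt0//; lra.
    by apply: lt_le_trans v_ge; rewrite mulr_gt0// exprn_gt0//; lra.
  rewrite pmulr_rgt0//; apply: mulr_gt0; last exact: exprn_gt0.
  by rewrite divr_gt0// !mulr_gt0//; lra.
- rewrite /Q coef_laguerre2_cosfactp !mulrA -expr2 sqrr_sign mul1r.
  have l0 : (0 : R) <= (n./2)%:R := ler0n _ _.
  have b0 : (0 < 'C(n, (n./2).*2))%N by rewrite bin_gt0; lia.
  by apply: divr_gt0; [apply: mulr_gt0; rewrite ?ltr0n|apply: mulr_gt0; lra].
Qed.

Lemma posrooted_cosfactp2 n : posrooted (laguerre_mult 1 (cosfactp R n)).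
Proof.
apply: posrooted_laguerre_pred; first lra.
by have -> : 1 + 1 = 2 :> R by []; exact: posrooted_cosfactp4.
Qed.

End squeezed_ball_poly4.

(** * Functional equation of Gamma *)

Section Gamma_function.
Variable R : realType.
Implicit Types (x y t : R).
Notation mu := (@lebesgue_measure R).

Let g y t : R := t `^ y * expR (- t).
Let E t : R := expR (- 2^-1 * t).

Let g_ge0 y t : 0 <= g y t.
Proof. by rewrite mulr_ge0 ?powR_ge0 ?expR_ge0. Qed.

Let measurable_g y (D : set R) : measurable_fun D (g y).
Proof.
apply: (@measurable_funS _ _ _ _ setT) => //.
apply: measurable_funM; first exact: measurable_powR.
by apply: measurableT_comp => //; exact: measurable_expR.
Qed.

Let measurable_E (D : set R) : measurable_fun D E.
Proof.
apply: (@measurable_funS _ _ _ _ setT) => //.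
apply: measurableT_comp; first exact: measurable_expR.
exact: measurable_funM.
Qed.

(** Half of the exponential absorbs the power: t^y <= 1 + t^(n+1) when y < n + 1, and t^(n+1) <=
    2^(n+1) (n+1)! e^(t/2) by one term of the exponential series. The bound serves for finiteness,
    for limits at infinity and in [I_rec]. *)
Lemma powR_expR_bound y : 0 <= y ->
  exists2 C, 0 < C & forall t, 0 <= t -> g y t <= C * E t.
Proof.
move=> y0; pose n := Num.bound y.
have yn : y < n.+1%:R by rewrite (lt_trans (archi_boundP y0))// ltr_nat.
exists (1 + 2 ^+ n.+1 * n.+1`!%:R).
  by rewrite ltr_pwDl// mulr_ge0// exprn_ge0.
move=> t t0; have e : expR (- t) = E t * E t by rewrite -expRD; congr expR; field.
rewrite /g e mulrA ler_wpM2r ?expR_ge0//.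
have h : t `^ y <= 1 + t ^+ n.+1.
  have [t1|t1] := leP t 1.
    apply: (@le_trans _ _ 1); last by rewrite lerDl exprn_ge0.
    by have := ge0_ler_powR y0 t0 ler01 t1; rewrite powR1.
  apply: (@le_trans _ _ (t `^ n.+1%:R)); first by rewrite ler_powR// ltW.
  by rewrite powR_mulrn// lerDr.
have -> : E t = (expR (t / 2))^-1 by rewrite /E mulNr expRN mulrC.
rewrite ler_pdivrMr ?expR_gt0//; apply: (le_trans h).
have t2 : 0 <= t / 2 by rewrite divr_ge0.
have := expR_ge1Dxn n t2.
have f0 : 0 < n.+1`!%:R :> R by rewrite ltr0n fact_gt0.
have f1 : 1 <= n.+1`!%:R :> R by rewrite ler1n fact_gt0.
have E1 : 1 <= expR (t / 2) by have := expR_ge1Dx (t / 2); lra.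
move=> h1; rewrite mulrDl mul1r lerD//.
rewrite -mulrA -ler_pdivrMl ?exprn_gt0//. rewrite -ler_pdivrMl//.
have -> : n.+1`!%:R^-1 * (2 ^- n.+1 * t ^+ n.+1) = (t / 2) ^+ n.+1 / n.+1`!%:R.
  by rewrite expr_div_n mulrC [2 ^- _ * _]mulrC.
by apply: le_trans h1; rewrite lerDr.
Qed.

Let E_lim : E x @[x --> +oo] --> (0 : R).
Proof.
rewrite (_ : E = (fun z => expR (- z)) \o (fun z => 2^-1 * z)); last first.
  by apply/funext => x; rewrite /E /= mulNr.
apply: (@cvg_comp _ _ _ ( *%R 2^-1) (fun z => expR (- z)) _ (pinfty_nbhs R)).
  exact: gt0_cvgMry.
exact: cvgr_expR.
Qed.

Let g_lim y : 0 <= y -> g y x @[x --> +oo] --> (0 : R).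
Proof.
move=> /powR_expR_bound[C C0 gC].
apply: (@squeeze_cvgr _ _ _ _ (fun=> 0) (fun x => C * E x)).
- near=> x; rewrite g_ge0 gC//.
- exact: cvg_cst.
- rewrite -[X in _ --> X](mulr0 C); apply: cvgMr; exact: E_lim.
Unshelve. all: by end_near. Qed.

Let cont_E : continuous E.
Proof.
move=> x; apply: continuous_comp; last exact: continuous_expR.
apply: cvgMr; exact: cvg_id.
Qed.

Let cont_g y t : 0 < t -> {for t, continuous (g y)}.
Proof.
move=> t0; apply: continuousM.
  apply: differentiable_continuous; apply/derivable1_diffP.
  by have := is_derive1_powR y t0; case.
apply: continuous_comp; last exact: continuous_expR.
exact: continuousN.
Qed.

Let cont_g0 y : 0 < y -> g y x @[x --> 0^'+] --> g y 0.
Proof.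
move=> y0; rewrite /g powR0 ?gt_eqF// ; apply: cvgM; first exact: powR_cvg0.
apply: cvg_at_right_filter; apply: continuous_comp; last exact: continuous_expR.
exact: continuousN.
Qed.

Let dE x : is_derive x 1 E (- 2^-1 * E x).
Proof.
have h := is_derive1_comp (is_derive_expR (- 2^-1 * x)) (is_deriveZ (- 2^-1) (is_derive_id x (1 : R))).
by apply: (@is_derive_eq _ _ _ _ _ _ _ _ h); rewrite /GRing.scale /= mulr1 mulrC.
Qed.

Let integral_E : (\int[mu]_(t in `[0%R, +oo[) (E t)%:E = 2%:E)%E.
Proof.
have dF x : is_derive x 1 (- 2 *: E) (E x).
  apply: (@is_derive_eq _ _ _ _ _ _ _ _ (is_deriveZ (- 2) (dE x))).
  by rewrite /GRing.scale /=; field.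
rewrite (@ge0_continuous_FTC2y _ E (- 2 *: E) 0 0).
- rewrite (_ : (- 2 *: E) 0 = - 2 * E 0)//.
  by rewrite /E mulr0 expR0 mulr1 -EFinB sub0r opprK.
- by move=> x _; exact: expR_ge0.
- exact: continuous_subspaceT.
- rewrite -[X in _ --> X](mulr0 (-2)); apply: cvgMr; exact: E_lim.
- by move=> x _; have := dF x; case.
- apply: cvg_at_right_filter; apply: cvgMr; exact: cont_E.
- by move=> x _; rewrite derive1E; have [] := dF x.
Qed.

Let D := [set` `]0%R, +oo[] : set R.
Let mD : measurable D. Proof. exact: measurable_itv. Qed.

Let I y := (\int[mu]_(t in D) (g y t)%:E)%E.

Let mE : (\int[mu]_(t in D) (E t)%:E = 2%:E)%E.
Proof.
by rewrite integral_itv_obnd_cbnd ?integral_E//; apply/measurable_EFinP; exact: measurable_E.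
Qed.

Let I_fin y : 0 <= y -> (I y < +oo)%E.
Proof.
move=> /powR_expR_bound[C C0 gC].
apply: (@le_lt_trans _ _ (\int[mu]_(t in D) (C%:E * (E t)%:E))%E).
  apply: ge0_le_integral => //.
  - by move=> x _; rewrite lee_fin.
  - by apply/measurable_EFinP; exact: measurable_g.
  - under eq_fun do rewrite -EFinM; apply/measurable_EFinP.
    by apply: measurable_funM => //; exact: measurable_E.
  - by move=> x; rewrite /D /= in_itv /= andbT => /ltW x0; rewrite -EFinM lee_fin gC.
rewrite ge0_integralZl_EFin//; last 3 first.
- by move=> x _; rewrite lee_fin expR_ge0.
- by apply/measurable_EFinP; exact: measurable_E.
- exact: ltW.
by rewrite mE -EFinM ltry.
Qed.

Let I_gt0 y : 0 <= y -> (0 < I y)%E.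
Proof.
move=> y0; apply: (@lt_le_trans _ _ (expR (- 2))%:E); first by rewrite lte_fin expR_gt0.
have -> : (expR (-2))%:E = (\int[mu]_(t in `[1%R, 2%R]) cst (expR (- 2))%:E t)%E.
  rewrite integral_cst//= lebesgue_measure_itv /= lte_fin ltr1n /= -EFinD -EFinM.
  by congr (_%:E); ring.
apply: (@le_trans _ _ (\int[mu]_(t in `[1%R, 2%R]) (g y t)%:E)%E).
  apply: ge0_le_integral => //.
  - by move=> x _; rewrite lee_fin expR_ge0.
  - by apply/measurable_EFinP; exact: measurable_g.
  - move=> x; rewrite /= in_itv /= => /andP[x1 x2]; rewrite lee_fin /g.
    have := ler_powR x1 y0; rewrite powRr0 => h.
    by apply: le_trans (ler_peMl (expR_ge0 _) h); rewrite ler_expR lerN2.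
apply: ge0_subset_integral => //.
- by apply/measurable_EFinP; exact: measurable_g.
- by move=> x _; rewrite lee_fin.
- by move=> x; rewrite /D /= !in_itv /= andbT => /andP[x1 _]; apply: lt_le_trans x1.
Qed.

(** Integration by parts: g (y + 1) - (y + 1) g y is the derivative of - g (y + 1). It changes sign,
    whereas the fundamental theorem applied on the half-line concerns nonnegative functions; so
    [A * E] is added, with [A] given by [powR_expR_bound], and its integral is cancelled at the
    end. *)
Let I_rec y : 0 < y -> (I (y + 1) = (y + 1)%:E * I y)%E.
Proof.
move=> y0; have [C C0 gC] := powR_expR_bound (ltW y0).
have y1 : 0 < y + 1 by lra.
pose A := (y + 1) * C.
have A0 : 0 <= A by rewrite mulr_ge0// ltW.
pose h t := g (y + 1) t - (y + 1) * g y t + A * E t.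
have h_ge0 t : 0 <= t -> 0 <= h t.
  move=> t0; have : (y + 1) * g y t <= A * E t by rewrite /A -mulrA ler_pM2l ?gC.
  by have := g_ge0 (y + 1) t; rewrite /h; lra.
pose H t := - g (y + 1) t + (- 2 * A) * E t.
have dH t : 0 < t -> is_derive t 1 H (h t).
  move=> t0.
  have d1 := is_derive1_comp (is_derive_expR (- t)) (is_deriveN (is_derive_id t (1 : R))).
  have d2 := is_deriveM (is_derive1_powR (y + 1) t0) d1.
  have d3 := is_deriveD (is_deriveN d2) (is_deriveZ (- 2 * A) (dE t)).
  apply: (@is_derive_eq _ _ _ _ _ _ _ _ d3).
  by rewrite /GRing.scale /= /h /g addrK; field.
have ih : (\int[mu]_(t in D) (h t)%:E = (2 * A)%:E)%E.
  have mh : measurable_fun D h.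
    apply: measurable_funD; last by apply: measurable_funM => //; exact: measurable_E.
    apply: measurable_funB; first exact: measurable_g.
    by apply: measurable_funM => //; exact: measurable_g.
  rewrite /D integral_itv_obnd_cbnd; last exact/measurable_EFinP.
  rewrite (@ge0_continuous_FTC2y _ h H 0 0).
  - rewrite -EFinB; congr EFin.
    by rewrite /H /g powR0 ?gt_eqF// /E mulr0 expR0; ring.
  - by move=> t t0; exact: h_ge0.
  - apply/continuous_within_itvcyP; split.
      move=> t; rewrite in_itv /= andbT => t0.
      apply: cvgD; last by apply: cvgMr; exact: cont_E.
      apply: cvgB; first exact: cont_g.
      by apply: cvgMr; exact: cont_g.
    apply: cvgD; last by apply: cvgMr; apply: cvg_at_right_filter; exact: cont_E.
    apply: cvgB; first exact: cont_g0.
    by apply: cvgMr; exact: cont_g0.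
  - rewrite -[X in _ --> X]addr0 -{1}oppr0 -{2}(mulr0 (- 2 * A)).
    apply: cvgD; first by apply: cvgN; apply: g_lim; exact: ltW.
    by apply: cvgMr; exact: E_lim.
  - by move=> t /dH[].
  - apply: cvgD; first by apply: cvgN; apply: cont_g0.
    by apply: cvgMr; apply: cvg_at_right_filter; exact: cont_E.
  - move=> t; rewrite in_itv /= andbT => /dH[_ <-]; rewrite derive1E //.
have e1 : (\int[mu]_(t in D) ((h t)%:E + (y + 1)%:E * (g y t)%:E) =
           \int[mu]_(t in D) ((g (y + 1) t)%:E + A%:E * (E t)%:E))%E.
  by apply: eq_integral => t _; rewrite -!EFinM -!EFinD /h; congr (_%:E); ring.
have Dge0 t : D t -> 0 <= t by rewrite /D /= in_itv /= andbT => /ltW.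
have mgE z : measurable_fun D (fun t => (g z t)%:E) by apply/measurable_EFinP; exact: measurable_g.
have mEE : measurable_fun D (fun t => (E t)%:E) by apply/measurable_EFinP; exact: measurable_E.
have mh : measurable_fun D (fun t => (h t)%:E).
  apply/measurable_EFinP.
  apply: measurable_funD; last by apply: measurable_funM => //; exact: measurable_E.
  apply: measurable_funB; first exact: measurable_g.
  by apply: measurable_funM => //; exact: measurable_g.
have mgy : measurable_fun D (fun t => ((y + 1)%:E * (g y t)%:E)%E).
  under eq_fun do rewrite -EFinM.
  by apply/measurable_EFinP; apply: measurable_funM => //; exact: measurable_g.
have mAE : measurable_fun D (fun t => (A%:E * (E t)%:E)%E).
  under eq_fun do rewrite -EFinM.
  by apply/measurable_EFinP; apply: measurable_funM => //; exact: measurable_E.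
have h0 t : D t -> (0 <= (h t)%:E)%E by move=> /Dge0 t0; rewrite lee_fin h_ge0.
have gy0 t : D t -> (0 <= (y + 1)%:E * (g y t)%:E)%E.
  by move=> _; rewrite -EFinM lee_fin mulr_ge0// ltW.
have g10 t : D t -> (0 <= (g (y + 1) t)%:E)%E by rewrite lee_fin.
have AE0 t : D t -> (0 <= A%:E * (E t)%:E)%E.
  by move=> _; rewrite -EFinM lee_fin mulr_ge0// expR_ge0.
have /= e2 := ge0_integralD mu mD h0 mh gy0 mgy.
have /= e3 := ge0_integralD mu mD g10 (mgE _) AE0 mAE.
move: e1; rewrite e2 e3.
have E0 t : D t -> (0 <= (E t)%:E)%E by rewrite lee_fin expR_ge0.
have gz0 t : D t -> (0 <= (g y t)%:E)%E by rewrite lee_fin.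
have /= e4 := ge0_integralZl_EFin mu mD E0 mEE A0.
have /= e5 := ge0_integralZl_EFin mu mD gz0 (mgE y) (ltW y1).
rewrite e4 e5.
rewrite ih mE -EFinM [A * 2]mulrC addeC.
rewrite -/(I y) -/(I (y + 1)).
have I1 : I y \is a fin_num by rewrite ge0_fin_numE ?I_fin ?ltW// I_gt0// ltW.
have I2 : I (y + 1) \is a fin_num by rewrite ge0_fin_numE ?I_fin ?ltW// I_gt0// ltW.
rewrite -(fineK I1) -(fineK I2) -EFinM -!EFinD => -[] /addIr <-.
by [].
Qed.

(** A real-valued integral is 0 by convention when the extended one is infinite, so finiteness
    matters here as much as positivity. *)
Lemma Gamma_gt0 x : 1 <= x -> 0 < Gamma x.
Proof.
move=> x1; rewrite /Gamma /Rintegral; apply: fine_gt0.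
by rewrite I_gt0 ?I_fin ?subr_ge0.
Qed.

Lemma Gamma_rec x : 1 < x -> Gamma (x + 1) = x * Gamma x.
Proof.
move=> x1; rewrite /Gamma /Rintegral.
have := @I_rec (x - 1); rewrite subr_gt0 x1 subrK => /(_ isT).
have x10 : 0 <= x - 1 by rewrite subr_ge0 ltW.
have If : I (x - 1) \is a fin_num by rewrite ge0_fin_numE ?I_fin// ltW// I_gt0.
by rewrite addrK /I /D => ->; rewrite fineM.
Qed.
End Gamma_function.

(** * Volumes by slicing *)

Section radial_integrals.
Variable R : realType.
Implicit Types (x y q a r : R) (k : nat).
Notation mu := (@lebesgue_measure R).

Lemma ge0_integral_shift (f : R -> \bar R) a : measurable_fun setT f ->
  (forall x, 0 <= f x)%E -> (\int[mu]_x f (x + a)%R = \int[mu]_x f x)%E.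
Proof.
move=> mf f0.
have ms : measurable_fun setT ((fun x => x + a) : measurableTypeR R -> measurableTypeR R).
  exact: measurable_funD.
have := ge0_integral_pushforward ms mu measurableT mf (fun x _ => f0 x).
rewrite preimage_setT => /= <-.
apply: eq_measure_integral => A mA _; apply/esym/lebesgue_measure_unique => //= _ [[b c]] _ <-.
rewrite /pushforward.
have -> : (fun x => x + a) @^-1` `]b, c]%classic = `]b - a, c - a]%classic.
  by apply/seteqP; split => x /=; rewrite !in_itv /=; lra.
rewrite !lebesgue_measure_itv /= !lte_fin ltrD2r; case: ifP => // _.
by rewrite -!EFinD; congr EFin; ring.
Qed.

Lemma ge0_integral_dilation (f : R -> \bar R) r : 0 < r -> measurable_fun setT f ->
  (forall x, 0 <= f x)%E -> (r%:E * \int[mu]_x f (r * x)%R = \int[mu]_x f x)%E.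
Proof.
move=> r0 mf f0.
have ms : measurable_fun setT ((fun x => r * x) : measurableTypeR R -> measurableTypeR R).
  exact: measurable_funM.
have := ge0_integral_pushforward ms mu measurableT mf (fun x _ => f0 x).
rewrite preimage_setT => /= <-.
pose r' := NngNum (ltW r0).
have -> : r%:E = r'%:num%:E by [].
rewrite -ge0_integral_mscale//.
apply: eq_measure_integral => A mA _; apply/esym/lebesgue_measure_unique => //= _ [[b c]] _ <-.
rewrite /mscale /= /pushforward.
have -> : (fun x => r * x) @^-1` `]b, c]%classic = `]b / r, c / r]%classic.
  by apply/seteqP; split => x /=; rewrite !in_itv /= ltr_pdivrMr// ler_pdivlMr// mulrC.
rewrite !lebesgue_measure_itv /= !lte_fin ltr_pM2r ?invr_gt0//; case: ifP => // _.
  by rewrite -EFinM; congr EFin; field; rewrite gt_eqF.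
by rewrite mule0.
Qed.

(** Times [ball_coef k], the volume of the ball of squared radius q in R^k, empty for q < 0. The
    indicator is there for k = 0, where the power alone would be 1 also for negative q. *)
Definition radial k q : R := (0 <= q)%R%:R * Num.sqrt q ^+ k.

Lemma radial_ge0 k q : 0 <= radial k q.
Proof. by rewrite mulr_ge0// exprn_ge0// sqrtr_ge0. Qed.

Lemma radial_sqr k r : 0 <= r -> radial k (r ^+ 2) = r ^+ k.
Proof. by move=> r0; rewrite /radial sqr_ge0 mul1r sqrtr_sqr ger0_norm. Qed.

Lemma measurable_radial k : measurable_fun setT (radial k).
Proof.
apply: measurable_funM.
  rewrite (_ : (fun q => _) = \1_`[0, +oo[%classic); first exact: measurable_indic.
  by apply/funext => x; rewrite indicE mem_setE in_itv /= andbT.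
apply: measurable_funX; apply: continuous_measurable_fun; exact: sqrt_continuous.
Qed.

Lemma measurable_radial_sub k q : measurable_fun setT (fun x => radial k (q - x ^+ 2)).
Proof.
apply: measurableT_comp; first exact: measurable_radial.
by apply: measurable_funB => //; exact: measurable_funX.
Qed.

Let J k := (\int[mu]_x (radial k (1 - x ^+ 2))%:E)%E.
(* The ratio of the volumes of the unit balls of R^(k+1) and R^k. *)
Definition slice_coef k : R := fine (J k).

Let JE k : (J k = \int[mu]_(x in `[(-1)%R, 1%R]) (Num.sqrt (1 - x ^+ 2) ^+ k)%:E)%E.
Proof.
rewrite /J [RHS]integral_mkcond; apply: eq_integral => x _.
rewrite patchE mem_setE in_itv /= /radial -ler_norml subr_ge0.
have -> : (x ^+ 2 <= 1) = (`|x| <= 1) by rewrite -real_normK ?num_real// expr_le1.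
by case: ifP; rewrite ?mul1r ?mul0r.
Qed.

Let cont_sqrt k : continuous (fun x : R => Num.sqrt (1 - x ^+ 2) ^+ k).
Proof.
move=> x.
apply: (@continuous_comp _ _ _ (fun x : R => Num.sqrt (1 - x ^+ 2)) (fun y => y ^+ k)).
  apply: (@continuous_comp _ _ _ (fun x : R => 1 - x ^+ 2) (@Num.sqrt R)).
    apply: cvgB; first exact: cvg_cst.
    exact: exprn_continuous.
  exact: sqrt_continuous.
exact: exprn_continuous.
Qed.

Let J_fin k : (J k < +oo)%E.
Proof.
rewrite JE; apply: (@le_lt_trans _ _ (\int[mu]_(x in `[(-1)%R, 1%R]) cst 1%:E x)%E).
  apply: ge0_le_integral => //.
  - apply/measurable_EFinP; apply: (@measurable_funS _ _ _ _ setT) => //.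
    exact: continuous_measurable_fun.
  - move=> x; rewrite /= in_itv /= => xi; rewrite lee_fin exprn_ile1// ?sqrtr_ge0//.
    by rewrite -[X in _ <= X]sqrtr1 ler_wsqrtr// lerBlDr lerDl sqr_ge0.
rewrite integral_cst//= lebesgue_measure_itv /= lte_fin.
by case: ifP; rewrite ?mule0 ?ltry// -EFinD -EFinM ltry.
Qed.

Let J_gt0 k : (0 < J k)%E.
Proof.
have s0 : 0 < Num.sqrt (3 / 4) ^+ k :> R by rewrite exprn_gt0// sqrtr_gt0.
apply: (@lt_le_trans _ _ (\int[mu]_(x in `[0%R, (1 / 2)%R]) cst (Num.sqrt (3 / 4) ^+ k)%:E x)%E).
  rewrite integral_cst//= lebesgue_measure_itv /= lte_fin ifT; last by lra.
  by rewrite -EFinD -EFinM lte_fin mulr_gt0//; lra.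
rewrite JE; apply: (@le_trans _ _ (\int[mu]_(x in `[0%R, (1 / 2)%R]) (Num.sqrt (1 - x ^+ 2) ^+ k)%:E)%E).
  apply: ge0_le_integral => //.
  - by move=> x _; rewrite lee_fin ltW.
  - apply/measurable_EFinP; apply: (@measurable_funS _ _ _ _ setT) => //.
    exact: continuous_measurable_fun.
  - move=> x; rewrite /= in_itv /= => xi; rewrite lee_fin lerXn2r// ?nnegrE ?sqrtr_ge0//.
    by rewrite ler_wsqrtr//; nra.
apply: ge0_subset_integral => //.
- apply/measurable_EFinP; apply: (@measurable_funS _ _ _ _ setT) => //.
  exact: continuous_measurable_fun.
- by move=> x; rewrite /= !in_itv /=; lra.
Qed.

Lemma slice_coef_gt0 k : 0 < slice_coef k.
Proof. by apply: fine_gt0; rewrite J_gt0 J_fin. Qed.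

Let JcE k : J k = (slice_coef k)%:E.
Proof. by rewrite /slice_coef fineK// ge0_fin_numE ?J_fin// ltW. Qed.

(** One slicing step: the section at x of a ball of squared radius q has squared radius q - x^2. A
    dilation by sqrt q reduces to q = 1; for q <= 0 the integrand vanishes away from 0. *)
Lemma integral_radial k q :
  (\int[mu]_x (radial k (q - x ^+ 2))%:E = (slice_coef k * radial k.+1 q)%:E)%E.
Proof.
have [q0|q0] := ltP 0 q; last first.
  rewrite (_ : radial k.+1 q = 0); last first.
    by rewrite /radial; move: q0; rewrite le_eqVlt => /predU1P[->|q0];
      [rewrite sqrtr0 expr0n mulr0|rewrite leNgt q0 mul0r].
  rewrite mulr0.
  transitivity (\int[mu]_(x in [set (0%R : R)]) (radial k (q - x ^+ 2))%:E)%E.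
    rewrite [RHS]integral_mkcond; apply: eq_integral => x _.
    rewrite patchE; case: ifPn => //; rewrite notin_setE /= => /eqP x0.
    rewrite /radial leNgt subr_lt0 (le_lt_trans q0) ?mul0r//.
    by rewrite exprn_even_gt0.
  exact: integral_set1.
have r0 : 0 < Num.sqrt q by rewrite sqrtr_gt0.
rewrite -(ge0_integral_dilation r0); last 2 first.
- by apply/measurable_EFinP; exact: measurable_radial_sub.
- by move=> x; rewrite lee_fin radial_ge0.
have e x : radial k (q - (Num.sqrt q * x) ^+ 2) = Num.sqrt q ^+ k * radial k (1 - x ^+ 2).
  have -> : q - (Num.sqrt q * x) ^+ 2 = q * (1 - x ^+ 2).
    by rewrite exprMn sqr_sqrtr ?ltW//; ring.
  rewrite /radial pmulr_rge0//; case: (0 <= _); last by rewrite !mul0r mulr0.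
  by rewrite !mul1r sqrtrM ?ltW// exprMn.
under eq_integral do rewrite e EFinM.
rewrite ge0_integralZl_EFin//.
- rewrite -/(J k) JcE -!EFinM; congr EFin.
  by rewrite /radial ltW// mul1r exprS; ring.
- by move=> x _; rewrite lee_fin radial_ge0.
- by apply/measurable_EFinP; exact: measurable_radial_sub.
Qed.

(** Wallis recursion: x (1 - x^2)^((k+2)/2) vanishes at both ends of [-1, 1], and [f] is its
    derivative. *)
Lemma slice_coef_rec k : k.+3%:R * slice_coef k.+2 = k.+2%:R * slice_coef k.
Proof.
pose F x := x * Num.sqrt (1 - x ^+ 2) ^+ k.+2.
pose f x := k.+3%:R * Num.sqrt (1 - x ^+ 2) ^+ k.+2 - k.+2%:R * Num.sqrt (1 - x ^+ 2) ^+ k.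
have dF x : x \in `](-1), 1[ -> is_derive x 1 F (f x).
  rewrite in_itv /= => x1.
  have p : 0 < 1 - x ^+ 2 by nra.
  have d1 := is_deriveB (is_derive_cst (1 : R) x 1) (is_deriveX 2 (is_derive_id x (1 : R))).
  have d2 := @is_derive1_comp _ (@Num.sqrt R) (cst 1 - id ^+ 2) x _ _ (is_derive1_sqrt p) d1.
  have d3 := is_deriveM (is_derive_id x (1 : R)) (is_deriveX k.+2 d2).
  have -> : F = id * (@Num.sqrt R \o (cst 1 - id ^+ 2)) ^+ k.+2.
    by apply/funext => y; rewrite /F !fctE.
  apply: (@is_derive_eq _ _ _ _ _ _ _ _ d3).
  rewrite [(@Num.sqrt R \o _)](_ : _ = fun y => Num.sqrt (1 - y ^+ 2)); last first.
    by apply/funext => y; rewrite /= !fctE.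
  rewrite !fctE /GRing.scale /= /f -[k.+3%:R]natr1 !exprS !expr0 !mulr1.
  set S := Num.sqrt _; set c := k.+2%:R; set P := S ^+ k.
  have s0 : S != 0 by rewrite gt_eqF// sqrtr_gt0.
  have s2 : x * x = 1 - S * S by rewrite -[S * S]expr2 sqr_sqrtr ?ltW//; ring.
  transitivity (c * P * - (x * x) + S * (S * P)); first by field.
  by rewrite s2; ring.
have cf : continuous f.
  move=> x; apply: cvgB; apply: cvgMr; exact: cont_sqrt.
have cF : continuous F.
  move=> x; apply: cvgM; [exact: cvg_id|exact: cont_sqrt].
have If : (\int[mu]_(x in `[(-1)%R, 1%R]) (f x)%:E = 0)%E.
  rewrite (@continuous_FTC2 _ f F)//.
  - by rewrite /F sqrrN expr1n subrr sqrtr0 expr0n !mulr0 subee.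
  - exact: continuous_subspaceT.
  - split.
    + by move=> x /dF[].
    + apply: cvg_at_right_filter; exact: cF.
    + apply: cvg_at_left_filter; exact: cF.
  - by move=> x /dF[_ <-]; rewrite derive1E.
have iJ j (c : R) : mu.-integrable `[(-1)%R, 1%R] (fun x => (c * Num.sqrt (1 - x ^+ 2) ^+ j)%:E).
  apply: continuous_compact_integrable; first exact: segment_compact.
  by apply: continuous_subspaceT => x; apply: cvgMr; exact: cont_sqrt.
have IJ j (c : R) : (\int[mu]_(x in `[(-1)%R, 1%R]) (c * Num.sqrt (1 - x ^+ 2) ^+ j)%:E = (c * slice_coef j)%:E)%E.
  under eq_integral do rewrite EFinM.
  rewrite integralZl//; first by rewrite -JE JcE.
  have -> : (fun x => (Num.sqrt (1 - x ^+ 2) ^+ j)%:E) = (fun x => (1 * Num.sqrt (1 - x ^+ 2) ^+ j)%:E).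
    by apply/funext => x; rewrite mul1r.
  exact: iJ.
move: If; rewrite /f; under eq_integral do rewrite EFinB.
rewrite integralB//.
by rewrite !IJ -EFinB => -[] /eqP; rewrite subr_eq0 => /eqP.
Qed.

(* The distance from [x] to [-1, 1] is [Num.max (`|x| - 1) 0]. *)
Lemma integral_slab (G : R -> R) q : measurable_fun setT G -> (forall x, 0 <= G x) ->
  (\int[mu]_x (G (q - Num.max (`|x| - 1) 0 ^+ 2))%:E =
   (2 * G q)%:E + \int[mu]_x (G (q - x ^+ 2))%:E)%E.
Proof.
move=> mG G0.
pose P x := G (q - x ^+ 2) * \1_`]0, +oo[%classic x.
pose N x := G (q - x ^+ 2) * \1_`]-oo, 0]%classic x.
have mGq : measurable_fun setT (fun x => G (q - x ^+ 2)).
  by apply: measurableT_comp => //; apply: measurable_funB => //; exact: measurable_funX.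
have mP : measurable_fun setT (fun x => (P x)%:E).
  by apply/measurable_EFinP; apply: measurable_funM => //; exact: measurable_indic.
have mN : measurable_fun setT (fun x => (N x)%:E).
  by apply/measurable_EFinP; apply: measurable_funM => //; exact: measurable_indic.
have P0 x : (0 <= (P x)%:E)%E by rewrite lee_fin mulr_ge0.
have N0 x : (0 <= (N x)%:E)%E by rewrite lee_fin mulr_ge0.
have PN x : ((G (q - x ^+ 2))%:E = (P x)%:E + (N x)%:E)%E.
  rewrite -EFinD /P /N !indicE !mem_setE !in_itv /= andbT; congr EFin.
  by case: ltP => _; rewrite ?mulr1 ?mulr0 ?addr0 ?add0r.
(* The interval (-1, 1] contributes 2 G(q), and the two outer rays, moved inwards by 1, are the
   halves [P] and [N] of the line. The half-open intervals make this an identity at every point. *)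
have e x : ((G (q - Num.max (`|x| - 1) 0 ^+ 2))%:E =
    ((G q)%:E * (\1_`](-1), 1]%classic x)%:E + (P (x + - 1)%R)%:E) + (N (x + 1)%R)%:E)%E.
  rewrite -EFinM -!EFinD /P /N !indicE !mem_setE !in_itv /= andbT; congr EFin.
  have [x1|x1] := ltP 1 x.
    have -> : (x + 1 <= 0) = false by apply/negbTE; rewrite -ltNge; lra.
    have -> : 0 < x + - 1 by lra.
    rewrite andbF !mulr0 add0r mulr1 addr0 max_l ger0_norm//; lra.
  have -> : (0 < x + - 1) = false by apply/negbTE; rewrite -leNgt; lra.
  rewrite andbT !mulr0 addr0; have [xN1|xN1] := ltP (- 1) x.
    have -> : (x + 1 <= 0) = false by apply/negbTE; rewrite -ltNge; lra.
    rewrite mulr1 mulr0 addr0 max_r ?expr0n ?subr0// subr_le0 ler_norml; lra.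
  have -> : x + 1 <= 0 by lra.
  rewrite mulr0 add0r mulr1 max_l ler0_norm; [|lra|lra|lra].
  by congr (G (q - _)); ring.
have mPs : measurable_fun setT (fun x => (P (x + - 1))%:E).
  by apply: (@measurableT_comp _ _ _ _ _ _ (fun x => (P x)%:E)) => //; exact: measurable_funD.
have mNs : measurable_fun setT (fun x => (N (x + 1))%:E).
  by apply: (@measurableT_comp _ _ _ _ _ _ (fun x => (N x)%:E)) => //; exact: measurable_funD.
have mI : measurable_fun setT (fun x : R => ((G q)%:E * (\1_`](-1), 1]%classic x)%:E)%E).
  under eq_fun do rewrite -EFinM; apply/measurable_EFinP.
  by apply: measurable_funM => //; exact: measurable_indic.
have I0 (x : R) : (0 <= (G q)%:E * (\1_`](-1), 1]%classic x)%:E)%E.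
  by rewrite -EFinM lee_fin mulr_ge0.
under eq_integral do rewrite e.
rewrite ge0_integralD//; last 2 first.
- by move=> x _; rewrite adde_ge0.
- exact: emeasurable_funD.
rewrite ge0_integralD//.
rewrite ge0_integralZl_EFin//; last by apply/measurable_EFinP; exact: measurable_indic.
have m2 : lebesgue_measure `](-1 : R), 1]%classic = 2%:E.
  by rewrite lebesgue_measure_itv /= lte_fin ifT ?EFinN ?oppeK//; lra.
rewrite integral_indic// setIT [X in (_ * X + _ + _)%E](_ : _ = 2%:E)//.
rewrite (ge0_integral_shift (-1) mP P0) (ge0_integral_shift 1 mN N0).
under [in RHS]eq_integral do rewrite PN.
rewrite ge0_integralD// -addeA; congr (_ + _)%E.
by rewrite -EFinM mulrC.
Qed.

End radial_integrals.

Local Arguments cons_pair : simpl never.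

(** * Volumes of balls, neighbourhoods of slabs, and bodies of revolution *)

Section tuple_volumes.
Variable R : realType.
Implicit Types (x y q r : R) (k j m n : nat).
Notation mu := (@lebesgue_measure R).
Notation lambda := (tuple_lebesgue R).

Lemma tuple_lebesgue_cons m (A : set (m.+1.-tuple (measurableTypeR R))) :
  (lambda m.+1 A = \int[mu]_x lambda m [set t | A (cons_pair (x, t))])%E.
Proof.
rewrite /= /cons_measure /pushforward /product_measure1 /=.
apply: eq_integral => x _; congr (tuple_lebesgue R m _).
by apply/seteqP; split => t /=; rewrite /xsection /= inE.
Qed.

(* The volume of the unit ball of R^m. *)
Definition ball_coef m : R := \prod_(i < m) slice_coef R i.

Lemma ball_coefS m : ball_coef m.+1 = ball_coef m * slice_coef R m.
Proof. by rewrite /ball_coef big_ord_recr. Qed.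

Lemma ball_coef_gt0 m : 0 < ball_coef m.
Proof. by apply: prodr_gt0 => i _; exact: slice_coef_gt0. Qed.

(* Squared distance to the product of [k] intervals [-1, 1] and [m - k] points 0. *)
Definition slab_sq k m (t : m.-tuple (measurableTypeR R)) : R :=
  \sum_(i < m) (if (i < k)%N then Num.max (`|tnth t i| - 1) 0 else tnth t i) ^+ 2.

Lemma slab_sq0_cons m (x : measurableTypeR R) (t : m.-tuple (measurableTypeR R)) :
  slab_sq 0 (cons_pair (x, t)) = x ^+ 2 + slab_sq 0 t.
Proof.
rewrite /slab_sq big_ord_recl /= tnth0; congr (_ + _).
by apply: eq_bigr => i _; rewrite tnthS.
Qed.

Lemma slab_sqS_cons k m (x : measurableTypeR R) (t : m.-tuple (measurableTypeR R)) :
  slab_sq k.+1 (cons_pair (x, t)) = Num.max (`|x| - 1) 0 ^+ 2 + slab_sq k t.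
Proof.
rewrite /slab_sq big_ord_recl /= tnth0; congr (_ + _).
by apply: eq_bigr => i _; rewrite tnthS.
Qed.

Lemma measurable_radialM (c : R) k :
  measurable_fun setT (fun q => c * radial k q).
Proof. by apply: measurable_funM => //; exact: measurable_radial. Qed.

Lemma volume_ball_tuple m q :
  lambda m [set t | slab_sq 0 t <= q] = (ball_coef m * radial m q)%:E.
Proof.
elim: m q => [|m IH] q.
  rewrite /= diracE /ball_coef /radial big_ord0 expr0 !mul1r mulr1.
  rewrite /slab_sq; congr (_%:E); congr (nat_of_bool _)%:R.
  by apply/idP/idP; rewrite inE /= big_ord0.
rewrite tuple_lebesgue_cons.
under eq_integral => x _.
  rewrite (_ : [set t | _] = [set t | slab_sq 0 t <= q - x ^+ 2]); last first.
    by apply/seteqP; split => t /=; rewrite slab_sq0_cons lerBrDl.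
  rewrite IH EFinM; over.
rewrite ge0_integralZl_EFin//.
- by rewrite integral_radial -EFinM ball_coefS mulrA.
- by move=> x _; rewrite lee_fin radial_ge0.
- by apply/measurable_EFinP; exact: measurable_radial_sub.
- by rewrite ltW// ball_coef_gt0.
Qed.

(** Volume in R^(k + j) of the points at squared distance at most q from [-1, 1]^k x 0. The i-th
    term collects those with exactly i of the first k coordinates outside [-1, 1]: the other k - i
    give the factor 2^(k-i). *)
Definition slab_volume k j q : R :=
  \sum_(i < k.+1) 'C(k, i)%:R * 2 ^+ (k - i) * ball_coef (j + i) * radial (j + i) q.

Lemma slab_volume_ge0 k j q : 0 <= slab_volume k j q.
Proof.
apply: sumr_ge0 => i _; rewrite mulr_ge0 ?radial_ge0// mulr_ge0 ?(ltW (ball_coef_gt0 _))//.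
Qed.

Lemma measurable_slab_volume k j : measurable_fun setT (slab_volume k j).
Proof. by apply: measurable_sum => i; exact: measurable_radialM. Qed.

Lemma integral_slab_volume k j q :
  (\int[mu]_x (slab_volume k j (q - x ^+ 2))%:E =
   (\sum_(i < k.+1) 'C(k, i)%:R * 2 ^+ (k - i) * ball_coef (j + i).+1 * radial (j + i).+1 q)%:E)%E.
Proof.
have c0 i : 0 <= 'C(k, i)%:R * 2 ^+ (k - i) * ball_coef (j + i).
  by rewrite mulr_ge0 ?(ltW (ball_coef_gt0 _))// mulr_ge0// exprn_ge0.
under eq_integral do rewrite /slab_volume -sumEFin.
rewrite ge0_integral_sum//.
- rewrite -sumEFin; apply: eq_bigr => i _.
  under eq_integral do rewrite EFinM.
  rewrite ge0_integralZl_EFin//.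
  + by rewrite integral_radial -EFinM ball_coefS !mulrA.
  + by move=> x _; rewrite lee_fin radial_ge0.
  + by apply/measurable_EFinP; exact: measurable_radial_sub.
- move=> i; apply/measurable_EFinP.
  by apply: measurable_funM => //; exact: measurable_radial_sub.
- by move=> i x _; rewrite lee_fin mulr_ge0// radial_ge0.
Qed.

(** Pascal's rule, the two terms standing for a new coordinate inside or outside [-1, 1], as in
    [integral_slab]. *)
Lemma slab_volumeS k j q : slab_volume k.+1 j q = 2 * slab_volume k j q +
  \sum_(i < k.+1) 'C(k, i)%:R * 2 ^+ (k - i) * ball_coef (j + i).+1 * radial (j + i).+1 q.
Proof.
pose T i := ball_coef (j + i) * radial (j + i) q.
rewrite /slab_volume mulr_sumr.
transitivity (\sum_(i < k.+2) 'C(k, i)%:R * 2 ^+ (k.+1 - i) * T i +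
   \sum_(i < k.+1) 'C(k, i)%:R * 2 ^+ (k - i) * T i.+1).
  rewrite big_ord_recl [X in _ = X + _]big_ord_recl -addrA; congr (_ + _).
    by rewrite !bin0 /T !mulrA.
  rewrite -big_split /=; apply: eq_bigr => i _.
  by rewrite /bump /= !add1n binS natrD subSS /T; ring.
congr (_ + _); last first.
  by apply: eq_bigr => i _; rewrite /T addnS !mulrA.
rewrite big_ord_recr /= bin_small// !mul0r addr0; apply: eq_bigr => i _.
have ik : (i <= k)%N by rewrite -ltnS.
by rewrite subSn// exprS /T; ring.
Qed.

Lemma volume_slab_tuple k j q :
  lambda (k + j) [set t | slab_sq k t <= q] = (slab_volume k j q)%:E.
Proof.
elim: k q => [|k IH] q.
  by rewrite volume_ball_tuple /slab_volume big_ord1 addn0 bin0 expr0 !mul1r.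
rewrite tuple_lebesgue_cons.
under eq_integral => x _.
  rewrite (_ : [set t | _] =
    [set t : (k + j).-tuple (measurableTypeR R) | slab_sq k t <= q - Num.max (`|x| - 1) 0 ^+ 2]); last first.
    by apply/seteqP; split => t /=; rewrite slab_sqS_cons lerBrDl.
  rewrite IH; over.
rewrite integral_slab; [|exact: measurable_slab_volume|exact: slab_volume_ge0].
by rewrite integral_slab_volume -EFinD slab_volumeS.
Qed.

(** The measure slices along the first coordinate, whereas the axis of revolution is the last one.
    Each step peels off a coordinate x orthogonal to the axis, replacing w by w - x^2, and Tonelli
    exchanges x with the height h. *)
Lemma volume_revolution_tuple n (w : R -> R) : measurable_fun setT w ->
  (lambda n.+1 [set t | (\sum_(i < n) tnth t (lift ord_max i) ^+ 2 <= w (tnth t ord_max))%R] =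
   \int[mu]_h (ball_coef n * radial n (w h))%:E)%E.
Proof.
elim: n w => [|n IH] w mw.
  rewrite tuple_lebesgue_cons; apply: eq_integral => x _.
  rewrite /= diracE /ball_coef /radial big_ord0 expr0 !mul1r mulr1.
  congr (_%:E); congr (nat_of_bool _)%:R.
  by apply/idP/idP; rewrite inE /= big_ord0 (_ : ord_max = ord0) ?tnth0//; exact/val_inj.
rewrite tuple_lebesgue_cons.
under eq_integral => x _.
  rewrite (_ : [set t | _] = [set t : n.+1.-tuple (measurableTypeR R) |
     \sum_(i < n) tnth t (lift ord_max i) ^+ 2 <= w (tnth t ord_max) - x ^+ 2]); last first.
    have e (t : n.+1.-tuple (measurableTypeR R)) :
        \sum_(i < n.+1) tnth (cons_pair (x, t)) (lift ord_max i) ^+ 2 =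
        x ^+ 2 + \sum_(i < n) tnth t (lift ord_max i) ^+ 2.
      rewrite big_ord_recl; congr (_ + _).
      apply: eq_bigr => i _; rewrite -(tnthS x t); congr (_ ^+ 2); congr tnth.
      by apply/val_inj; rewrite /= /bump /= !add1n ltnS; case: (n <= i)%N.
    have l (t : n.+1.-tuple (measurableTypeR R)) : tnth (cons_pair (x, t)) ord_max = tnth t ord_max.
      by rewrite -(tnthS x t); congr tnth; exact/val_inj.
    by apply/seteqP; split => t /=; rewrite e l lerBrDl.
  rewrite (IH (fun h => w h - x ^+ 2)); last exact: measurable_funB.
  over.
rewrite /=.
pose f (p : measurableTypeR R * measurableTypeR R) := (ball_coef n * radial n (w p.2 - p.1 ^+ 2))%:E.
have mf : measurable_fun setT f.
  apply/measurable_EFinP; apply: measurable_funM => //.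
  apply: measurableT_comp; first exact: measurable_radial.
  apply: measurable_funB; first exact: measurableT_comp.
  exact: measurable_funX.
have f0 p : (0 <= f p)%E.
  by rewrite lee_fin mulr_ge0 ?radial_ge0// ltW// ball_coef_gt0.
transitivity (\int[mu]_x \int[mu]_h f (x, h))%E; first by [].
rewrite (fubini_tonelli f mf f0); apply: eq_integral => h _.
rewrite /f /=; under eq_integral do rewrite EFinM.
rewrite ge0_integralZl_EFin//.
- by rewrite integral_radial -EFinM ball_coefS mulrA.
- by move=> x _; rewrite lee_fin radial_ge0.
- by apply/measurable_EFinP; exact: measurable_radial_sub.
- by rewrite ltW// ball_coef_gt0.
Qed.

End tuple_volumes.

(** * Steiner polynomials *)

Section steiner_polynomials.
Variable R : realType.
Implicit Types (x y q r t : R) (k j m n : nat).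
Notation mu := (@lebesgue_measure R).

Lemma poly_eq_nonneg (p q : {poly R}) : (forall t, 0 <= t -> p.[t] = q.[t]) -> p = q.
Proof.
move=> pq; apply/eqP; rewrite -subr_eq0; apply/negPn/negP => n0.
pose s := [seq i%:R : R | i <- iota 0 (size (p - q))].
have us : uniq s by rewrite map_inj_uniq ?iota_uniq//; exact: (mulrIn (oner_neq0 R)).
have rs : all (root (p - q)) s.
  apply/allP => _ /mapP[i _ ->]; apply/rootP.
  by rewrite hornerD hornerN pq ?subrr// ler0n.
by have := max_poly_roots n0 rs us; rewrite size_map size_iota ltnn.
Qed.

Lemma steiner_polyE m (V : set 'rV[R]_m) (P : {poly R}) :
  is_steiner_poly V P -> steiner_poly V = P.
Proof.
move=> PP; have [_ SE] : is_steiner_poly V (steiner_poly V) by apply: (@xgetPex _ 0); exists P.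
apply: poly_eq_nonneg => t t0; apply: EFin_inj.
by rewrite -SE// PP.2.
Qed.

(** The triangle inequality in squared form. Cauchy-Schwarz comes from the squares of y u - x v and
    a division by x y, so x = 0 and y = 0 are treated apart. *)
Lemma sumsqD m (u v : 'I_m -> R) x y : 0 <= x -> 0 <= y ->
  \sum_i u i ^+ 2 <= x ^+ 2 -> \sum_i v i ^+ 2 <= y ^+ 2 ->
  \sum_i (u i + v i) ^+ 2 <= (x + y) ^+ 2.
Proof.
move=> x0 y0 ux vy.
have zero (f : 'I_m -> R) : \sum_i f i ^+ 2 <= 0 -> forall i, f i = 0.
  move=> f0 i; apply/eqP; rewrite -sqrf_eq0; apply/eqP.
  have : \sum_i f i ^+ 2 = 0 by apply/eqP; rewrite eq_le f0 sumr_ge0// => l _; exact: sqr_ge0.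
  by move/psumr_eq0P; apply => // l _; exact: sqr_ge0.
have uv : \sum_i u i * v i <= x * y.
  have [x00|xn0] := eqVneq x 0.
    have u0 : forall i, u i = 0 by apply: zero; rewrite x00 expr0n in ux.
    by rewrite big1 ?mulr_ge0// => i _; rewrite u0 mul0r.
  have [y00|yn0] := eqVneq y 0.
    have v0 : forall i, v i = 0 by apply: zero; rewrite y00 expr0n in vy.
    by rewrite big1 ?mulr_ge0// => i _; rewrite v0 mulr0.
  have xp : 0 < x by rewrite lt_neqAle eq_sym xn0.
  have yp : 0 < y by rewrite lt_neqAle eq_sym yn0.
  have : 0 <= \sum_i (y * u i - x * v i) ^+ 2 by apply: sumr_ge0 => i _; exact: sqr_ge0.
  have -> : \sum_i (y * u i - x * v i) ^+ 2 =
      y ^+ 2 * \sum_i u i ^+ 2 + x ^+ 2 * \sum_i v i ^+ 2 - 2 * (x * y) * \sum_i u i * v i.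
    rewrite !mulr_sumr -!(big_split, sumrB) /=; apply: eq_bigr => i _; ring.
  have h1 : y ^+ 2 * \sum_i u i ^+ 2 <= y ^+ 2 * x ^+ 2 by rewrite ler_wpM2l// sqr_ge0.
  have h2 : x ^+ 2 * \sum_i v i ^+ 2 <= x ^+ 2 * y ^+ 2 by rewrite ler_wpM2l// sqr_ge0.
  move=> h3; rewrite -(ler_pM2l (mulr_gt0 xp yp)).
  by move: h1 h2 h3; set A := _ * \sum_i u i ^+ 2; set B := _ * \sum_i v i ^+ 2; nra.
have -> : \sum_i (u i + v i) ^+ 2 = \sum_i u i ^+ 2 + \sum_i v i ^+ 2 + 2 * \sum_i u i * v i.
  by rewrite mulr_sumr -!big_split /=; apply: eq_bigr => i _; ring.
by nra.
Qed.

Lemma unit_ballE m : unit_ball R m = [set x | \sum_i x ord0 i ^+ 2 <= 1].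
Proof.
suff e (x : 'rV[R]_m) : \sum_i `|x ord0 i| ^+ 2 = \sum_i x ord0 i ^+ 2.
  by apply/seteqP; split => x; rewrite /unit_ball /= e.
by apply: eq_bigr => i _; rewrite real_normK ?num_real.
Qed.

Lemma parallel_bodyE m (V : set 'rV[R]_m) t : 0 <= t ->
  parallel_body V t = [set v | exists2 a, V a & \sum_i (v ord0 i - a ord0 i) ^+ 2 <= t ^+ 2].
Proof.
move=> t0; rewrite /parallel_body unit_ballE; apply/seteqP; split => v /=.
  move=> [a Va [b bB <-]]; exists a => //.
  have -> : \sum_i ((a + t *: b) ord0 i - a ord0 i) ^+ 2 = t ^+ 2 * \sum_i b ord0 i ^+ 2.
    by rewrite mulr_sumr; apply: eq_bigr => i _; rewrite !mxE; ring.
  by rewrite ler_piMr ?sqr_ge0.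
move=> [a Va va]; exists a => //.
have [t00|tn0] := eqVneq t 0.
  exists 0; first by rewrite /= big1 ?ler01// => i _; rewrite mxE expr0n.
  rewrite scaler0 addr0; apply/rowP => i; apply/esym/eqP; rewrite -subr_eq0 -sqrf_eq0.
  rewrite t00 expr0n in va; apply/eqP.
  have : \sum_i (v ord0 i - a ord0 i) ^+ 2 = 0.
    by apply/eqP; rewrite eq_le va sumr_ge0// => l _; exact: sqr_ge0.
  by move/psumr_eq0P; apply => // l _; exact: sqr_ge0.
have tp : 0 < t by rewrite lt_neqAle eq_sym tn0.
exists (t^-1 *: (v - a)); last by rewrite scalerA divff// scale1r addrC subrK.
rewrite /=.
have -> : \sum_i (t^-1 *: (v - a)) ord0 i ^+ 2 = t ^- 2 * \sum_i (v ord0 i - a ord0 i) ^+ 2.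
  by rewrite mulr_sumr; apply: eq_bigr => i _; rewrite !mxE exprMn exprVn.
by rewrite ler_pdivrMl ?exprn_gt0// mulr1.
Qed.

Lemma parallel_ball m t : 0 <= t ->
  parallel_body (unit_ball R m) t = [set v | \sum_i v ord0 i ^+ 2 <= (1 + t) ^+ 2].
Proof.
move=> t0; rewrite parallel_bodyE// unit_ballE; apply/seteqP; split => v /=.
  move=> [a aB va].
  have -> : \sum_i v ord0 i ^+ 2 = \sum_i (a ord0 i + (v ord0 i - a ord0 i)) ^+ 2.
    by apply: eq_bigr => i _; rewrite addrC subrK.
  by apply: sumsqD; rewrite ?expr1n.
move=> vt; have t1 : 0 < 1 + t by lra.
have sc (c : R) : \sum_i (c * v ord0 i / (1 + t)) ^+ 2 <= c ^+ 2.
  have -> : \sum_i (c * v ord0 i / (1 + t)) ^+ 2 = c ^+ 2 / (1 + t) ^+ 2 * \sum_i v ord0 i ^+ 2.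
    rewrite mulr_sumr; apply: eq_bigr => i _; rewrite !exprMn exprVn; ring.
  by rewrite mulrAC ler_pdivrMr ?exprn_gt0// ler_wpM2l// sqr_ge0.
exists ((1 + t)^-1 *: v).
  rewrite /=; have := sc 1; rewrite expr1n; apply: le_trans.
  by apply: ler_sum => i _; rewrite mxE mul1r mulrC.
apply: le_trans (sc t); apply: ler_sum => i _; rewrite mxE le_eqVlt; apply/orP; left; apply/eqP.
by congr (_ ^+ 2); field; rewrite gt_eqF.
Qed.

(** The bound is 1 for i < k and 0 from there on, so that the cube is [slab m m], the squeezed cube
    is [slab n n.+1], and one computation serves both. *)
Definition slab k m : set 'rV[R]_m :=
  [set x | forall i : 'I_m, `|x ord0 i| <= (i < k)%:R].

Arguments slab : clear implicits.

Lemma unit_cube_slab m : unit_cube R m = slab m m.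
Proof.
apply/seteqP; split => x; rewrite /unit_cube /slab /=.
  move=> h i; rewrite ltn_ord; apply: le_trans h.
  by rewrite (bigmaxD1 i)// le_max lexx.
move=> h; apply: bigmax_le => // i _; by have := h i; rewrite ltn_ord.
Qed.

Lemma squeezed_cube_slab n : squeezed (unit_cube R n) = slab n n.+1.
Proof.
rewrite unit_cube_slab; apply/seteqP; split => x; rewrite /squeezed /slab /=.
  move=> [x0 h] i; have [j ->|->] := unliftP ord_max i; last by rewrite ltnn x0 normr0.
  by have := h j; rewrite mxE lift_max ltn_ord.
move=> h; split; first by have := h ord_max; rewrite ltnn normr_le0 => /eqP.
by move=> j; have := h (lift ord_max j); rewrite mxE lift_max ltn_ord.
Qed.

Lemma parallel_slab k m t : 0 <= t -> parallel_body (slab k m) t =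
  [set v : 'rV[R]_m | \sum_(i < m)
    (if (i < k)%N then Num.max (`|v ord0 i| - 1) 0 else v ord0 i) ^+ 2 <= t ^+ 2].
Proof.
move=> t0; rewrite parallel_bodyE//; apply/seteqP; split => v /=.
  move=> [a aV va]; apply: le_trans va; apply: ler_sum => i _.
  have := aV i; case: ifP => _; last by rewrite normr_le0 => /eqP ->; rewrite subr0.
  move=> ai.
  have h : Num.max (`|v ord0 i| - 1) 0 <= `|v ord0 i - a ord0 i|.
    rewrite ge_max normr_ge0 andbT.
    by apply: le_trans (lerB_dist _ _); rewrite lerD2l lerN2.
  rewrite -[X in _ <= X]real_normK ?num_real//.
  by apply: lerXn2r; rewrite ?nnegrE// le_max lexx orbT.
(* The nearest point of the slab: truncation to [-1, 1] in the first k coordinates, 0 in the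
   others. *)
move=> vt; exists (\row_i if (i < k)%N then Num.max (-1) (Num.min (v ord0 i) 1) else 0).
  move=> i; rewrite mxE; case: ifP => _; last by rewrite normr0.
  by rewrite ler_norml le_max lexx /= ge_max ge_min lexx orbT andbT; lra.
apply: le_trans vt; apply: ler_sum => i _; rewrite mxE.
case: ifP => _; last by rewrite subr0.
set x := v ord0 i; have [x1|x1] := leP x 1; last first.
  rewrite max_r; last by lra.
  by rewrite max_l ger0_norm; lra.
have [x2|x2] := leP (-1) x; first by rewrite subrr expr0n sqr_ge0.
rewrite ler0_norm; last by lra.
rewrite max_l; last by lra.
have -> : - x - 1 = - (x - - 1) by ring.
by rewrite sqrrN.
Qed.


Lemma steiner_unit_ball m : steiner_poly (unit_ball R m) = ball_coef R m *: (1 + 'X) ^+ m.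
Proof.
apply: steiner_polyE; split.
  apply: leq_trans (size_scale_leq _ _) _; apply: leq_trans (size_poly_exp_leq _ _) _.
  by rewrite addrC size_XaddC mul1n.
move=> t t0; rewrite /volume parallel_ball//.
rewrite (_ : [set s | _] = [set s | slab_sq 0 s <= (1 + t) ^+ 2]); last first.
  suff e (s : m.-tuple (measurableTypeR R)) :
      \sum_i (\row_i tnth s i) ord0 i ^+ 2 = slab_sq 0 s.
    by apply/seteqP; split => s /=; rewrite e.
  by rewrite /slab_sq; apply: eq_bigr => i _; rewrite mxE.
rewrite volume_ball_tuple radial_sqr; last by lra.
by rewrite hornerZ horner_exp !hornerE.
Qed.

Lemma steiner_slab k j : steiner_poly (slab k (k + j)) =
  \sum_(i < k.+1) ('C(k, i)%:R * 2 ^+ (k - i) * ball_coef R (j + i)) *: 'X^(j + i).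
Proof.
apply: steiner_polyE; split.
  apply: leq_trans (size_sum _ _ _) _; apply/bigmax_leqP => i _.
  apply: leq_trans (size_scale_leq _ _) _; rewrite size_polyXn ltnS addnC leq_add2r -ltnS.
  exact: ltn_ord.
move=> t t0; rewrite /volume parallel_slab//.
rewrite (_ : [set s | _] = [set s | slab_sq k s <= t ^+ 2]); last first.
  suff e (s : (k + j).-tuple (measurableTypeR R)) :
      \sum_(i < k + j) (if (i < k)%N then Num.max (`|(\row_i tnth s i) ord0 i| - 1) 0
        else (\row_i tnth s i) ord0 i) ^+ 2 = slab_sq k s.
    by apply/seteqP; split => s /=; rewrite e.
  by rewrite /slab_sq; apply: eq_bigr => i _; rewrite mxE.
rewrite volume_slab_tuple; congr EFin; rewrite horner_sum; apply: eq_bigr => i _.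
by rewrite hornerZ hornerXn radial_sqr.
Qed.

End steiner_polynomials.

Arguments slab : clear implicits.

(** * Steiner polynomial of the squeezed ball *)

Section squeezed_ball.
Variable R : realType.
Implicit Types (x y q r t h : R) (k j m n : nat).
Notation mu := (@lebesgue_measure R).

Lemma sum_lift_max n (f : 'I_n.+1 -> R) :
  \sum_i f i = \sum_(i < n) f (lift ord_max i) + f ord_max.
Proof.
rewrite big_ord_recr; congr (_ + _); apply: eq_bigr => i _; congr f.
by apply/val_inj; exact: esym (lift_max i).
Qed.

(* (1 + sqrt (t^2 - h^2))^2 when |h| <= t, and -1 otherwise. *)
Let w t h := (1 + Num.sqrt (t ^+ 2 - h ^+ 2)) ^+ 2 - 2 + 2 * radial 0 (t ^+ 2 - h ^+ 2).

Let w_in t h : 0 <= t ^+ 2 - h ^+ 2 -> w t h = (1 + Num.sqrt (t ^+ 2 - h ^+ 2)) ^+ 2.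
Proof. by move=> th; rewrite /w /radial th expr0 mulr1 /=; ring. Qed.

Let w_out t h : t ^+ 2 - h ^+ 2 < 0 -> w t h = - 1.
Proof.
by move=> th; rewrite /w /radial leNgt th mul0r mulr0 ltr0_sqrtr//; ring.
Qed.

(** At height h the section is the sum of the unit ball and a ball of radius sqrt(t^2 - h^2). For
    |h| > t the value -1 of [w] makes it empty, even when n = 0. *)
Lemma parallel_squeezed_ball n t : 0 <= t ->
  parallel_body (squeezed (unit_ball R n)) t =
  [set v : 'rV[R]_n.+1 | \sum_(i < n) v ord0 (lift ord_max i) ^+ 2 <= w t (v ord0 ord_max)].
Proof.
move=> t0; rewrite parallel_bodyE// unit_ballE; apply/seteqP; split => v /=.
  move=> [a [a0 aB]]; rewrite sum_lift_max a0 subr0 -lerBrDr => va.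
  set h := v ord0 ord_max in va *.
  have th : 0 <= t ^+ 2 - h ^+ 2.
    by apply: le_trans va; apply: sumr_ge0 => i _; exact: sqr_ge0.
  rewrite w_in//.
  have -> : \sum_(i < n) v ord0 (lift ord_max i) ^+ 2 = \sum_(i < n) (a ord0 (lift ord_max i) +
      (v ord0 (lift ord_max i) - a ord0 (lift ord_max i))) ^+ 2.
    by apply: eq_bigr => i _; rewrite addrC subrK.
  apply: sumsqD; rewrite ?sqrtr_ge0 ?sqr_sqrtr// expr1n.
  by apply: le_trans aB; apply: ler_sum => i _; rewrite mxE.
set h := v ord0 ord_max; set S := \sum_(i < n) _ => vw.
have S0 : 0 <= S by apply: sumr_ge0 => i _; exact: sqr_ge0.
have th : 0 <= t ^+ 2 - h ^+ 2.
  by rewrite leNgt; apply/negP => th; move: vw; rewrite w_out//; lra.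
rewrite w_in// in vw; set s := Num.sqrt _ in vw.
have s0 : 0 <= s by exact: sqrtr_ge0.
have s1 : 0 < 1 + s by lra.
have s2 : s ^+ 2 = t ^+ 2 - h ^+ 2 by rewrite sqr_sqrtr.
have S1 : S / (1 + s) ^+ 2 <= 1 by rewrite ler_pdivrMr ?exprn_gt0// mul1r.
(* The coordinates other than the last are shrunk by 1 + s, which brings them into the unit ball and
   moves them by s / (1 + s) times their norm, so by at most s. *)
exists (\row_i if i == ord_max then 0 else v ord0 i / (1 + s)).
  split; first by rewrite mxE eqxx.
  apply: le_trans S1; rewrite /S mulr_suml; apply: ler_sum => i _.
  by rewrite !mxE eq_sym (negPf (neq_lift _ _)) exprMn exprVn.
rewrite sum_lift_max mxE eqxx subr0 -lerBrDr -s2.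
have -> : \sum_(i < n) (v ord0 (lift ord_max i) - (\row_i if i == ord_max then 0 else v ord0 i / (1 + s)) ord0
    (lift ord_max i)) ^+ 2 = s ^+ 2 * (S / (1 + s) ^+ 2).
  rewrite mulrCA /S mulr_suml; apply: eq_bigr => i _.
  rewrite mxE eq_sym (negPf (neq_lift _ _)); field; exact: lt0r_neq0.
by rewrite ler_piMr// sqr_ge0.
Qed.

Let measurable_w t : measurable_fun setT (w t).
Proof.
have msq : measurable_fun setT (fun h : R => t ^+ 2 - h ^+ 2).
  by apply: measurable_funB => //; exact: measurable_funX.
apply: measurable_funD; last first.
  by apply: measurable_funM => //; exact: measurable_radial_sub.
apply: measurable_funB => //; apply: measurable_funX; apply: measurable_funD => //.
apply: (@measurableT_comp _ _ _ _ _ _ (@Num.sqrt R)) => //.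
by apply: continuous_measurable_fun; exact: sqrt_continuous.
Qed.

Let radial_w n t h : radial n (w t h) = \sum_(i < n.+1) 'C(n, i)%:R * radial i (t ^+ 2 - h ^+ 2).
Proof.
have [th|th] := leP 0 (t ^+ 2 - h ^+ 2).
  have s0 : 0 <= 1 + Num.sqrt (t ^+ 2 - h ^+ 2) by rewrite addr_ge0// sqrtr_ge0.
  rewrite w_in// radial_sqr// exprDn; apply: eq_bigr => i _.
  by rewrite expr1n mul1r /radial th mul1r mulr_natl.
rewrite w_out// /radial leNgt oppr_lt0 ltr01 mul0r big1// => i _.
by rewrite leNgt th mul0r mulr0.
Qed.

(** The binomial expansion of (1 + sqrt(t^2 - h^2))^n, integrated over h term by term. *)
Lemma steiner_squeezed_ball n : steiner_poly (squeezed (unit_ball R n)) =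
  \sum_(i < n.+1) (ball_coef R n * ('C(n, i)%:R * slice_coef R i)) *: 'X^(i.+1).
Proof.
apply: steiner_polyE; split.
  apply: leq_trans (size_sum _ _ _) _; apply/bigmax_leqP => i _.
  by apply: leq_trans (size_scale_leq _ _) _; rewrite size_polyXn !ltnS -ltnS ltn_ord.
move=> t t0; rewrite /volume parallel_squeezed_ball//.
rewrite (_ : [set s | _] = [set s : n.+1.-tuple (measurableTypeR R) |
   \sum_(i < n) tnth s (lift ord_max i) ^+ 2 <= w t (tnth s ord_max)]); last first.
  suff e (s : n.+1.-tuple (measurableTypeR R)) :
      \sum_(i < n) (\row_i tnth s i) ord0 (lift ord_max i) ^+ 2 = \sum_(i < n) tnth s (lift ord_max i) ^+ 2.
    by apply/seteqP; split => s /=; rewrite e mxE.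
  by apply: eq_bigr => i _; rewrite mxE.
rewrite volume_revolution_tuple; last exact: measurable_w.
have b0 := ltW (ball_coef_gt0 R n).
have bC i : 0 <= ball_coef R n * 'C(n, i)%:R by rewrite mulr_ge0.
under eq_integral => h _ do rewrite radial_w mulr_sumr -sumEFin.
have m i : measurable_fun setT (fun h : R => (radial i (t ^+ 2 - h ^+ 2))%:E).
  by apply/measurable_EFinP; exact: measurable_radial_sub.
rewrite ge0_integral_sum//.
- rewrite horner_sum -sumEFin; apply: eq_bigr => i _.
  under eq_integral do rewrite mulrA EFinM.
  rewrite ge0_integralZl_EFin//.
  + rewrite integral_radial -EFinM hornerZ hornerXn radial_sqr//; congr EFin; ring.
  + by move=> h _; rewrite lee_fin radial_ge0.
  + exact: m.
- move=> i; apply/measurable_EFinP.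
  apply: measurable_funM => //; apply: measurable_funM => //; exact: measurable_radial_sub.
- by move=> i h _; rewrite lee_fin !mulr_ge0// radial_ge0.
Qed.

End squeezed_ball.

(** * Weyl polynomials *)

Section weyl.
Variable R : realType.
Implicit Types (a : R) (k j m n l d p : nat).

Lemma Gamma_rising a l : 0 < a -> Gamma (a + l%:R + 1) = rising a l * Gamma (a + 1).
Proof.
move=> a0; elim: l => [|l IH]; first by rewrite addr0 /rising big_ord0 mul1r.
rewrite -natr1 addrA Gamma_rec; last by rewrite ltrDr ltr_wpDr.
by rewrite IH risingS -natr1; ring.
Qed.

Lemma weyl_coefE n (V : set 'rV[R]_n.+1) l :
  weyl_coef V l = 2 ^+ l * rising 2^-1 l * (steiner_poly V)`_(l.*2.+1).
Proof.
have h0 : 0 < 2^-1 :> R by [].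
rewrite /weyl_coef [l%:R + _]addrC Gamma_rising// mulfK// gt_eqF// Gamma_gt0//; lra.
Qed.

(* [weyl_poly_inf V] as a polynomial in v = -t^2. *)
Definition weylQ n (V : set 'rV[R]_n.+1) : {poly R} :=
  \poly_(l < n./2.+1) ((-1) ^+ l * weyl_coef V l).

Lemma comp_monomial_NX2 (c : R) l :
  (((-1) ^+ l * c) *: 'X^l) \Po (- 'X^2) = c *: 'X^(l.*2).
Proof.
rewrite comp_polyZ comp_Xn_poly [(- 'X^2) ^+ l]exprNn -exprM mul2n.
have -> : (-1) ^+ l * 'X^(l.*2) = ((-1) ^+ l : R) *: 'X^(l.*2).
  by rewrite -mul_polyC rmorphXn rmorphN1.
by rewrite scalerA mulrAC -expr2 sqrr_sign mul1r.
Qed.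

Lemma conservative_weyl_poly_inf n (V : set 'rV[R]_n.+1) :
  posrooted (weylQ V) -> conservative (weyl_poly_inf V).
Proof.
move=> /posrooted_conservative; rewrite /conservative.
suff -> : weyl_poly_inf V = weylQ V \Po (- 'X^2) by [].
rewrite /weyl_poly_inf big_mkord /weylQ poly_def raddf_sum /=; apply: eq_bigr => l _.
by rewrite comp_monomial_NX2.
Qed.

(** The quotient of Gamma values is the inverse of [rising (p%:R / 2) l], and the factor 2^-l is
    absorbed by v -> v / 2. *)
Lemma conservative_weyl_poly n (V : set 'rV[R]_n.+1) p : (0 < p)%N ->
  posrooted (laguerre_mult (p%:R / 2) (weylQ V)) -> conservative (weyl_poly V p).
Proof.
move=> p0; have a0 : 0 < p%:R / 2 :> R by rewrite divr_gt0// ltr0n.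
move=> /(@posrooted_scale _ 2^-1 _ _).
have h : 0 < 2^-1 :> R by [].
move=> /(_ h) /posrooted_conservative; rewrite /conservative.
set Q := (_ \Po (2^-1 *: 'X)).
suff -> : weyl_poly V p = Q \Po (- 'X^2) by [].
have -> : Q = \poly_(l < n./2.+1) ((-1) ^+ l * (2 ^- l / rising (p%:R / 2) l * weyl_coef V l)).
  apply/polyP => l; rewrite /Q coef_comp_scaleX coef_laguerre_mult !coef_poly.
  by case: ifP => _; rewrite ?mul0r ?mulr0// exprVn; ring.
rewrite /weyl_poly big_mkord poly_def raddf_sum /=; apply: eq_bigr => l _.
rewrite comp_monomial_NX2 Gamma_rising//.
have G0 : Gamma (p%:R / 2 + 1) != 0 :> R by rewrite gt_eqF// Gamma_gt0//; lra.
have r0 : rising (p%:R / 2 : R) l != 0 by rewrite gt_eqF// rising_gt0//; lra.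
suff -> : 2 ^- l * Gamma (p%:R / 2 + 1) / (rising (p%:R / 2) l * Gamma (p%:R / 2 + 1)) =
   2 ^- l / rising (p%:R / 2 : R) l by [].
by field; rewrite G0 r0 expf_neq0.
Qed.

Lemma conservative_weyl n (V : set 'rV[R]_n.+1) : posrooted (weylQ V) ->
  conservative (weyl_poly_inf V) /\ (forall p : nat, (1 <= p)%N -> conservative (weyl_poly V p)).
Proof.
move=> pV; split; first exact: conservative_weyl_poly_inf.
move=> p p1; apply: conservative_weyl_poly => //; apply: posrooted_laguerre => //.
by apply: (@lt_le_trans _ _ 0); rewrite ?oppr_lt0// divr_ge0.
Qed.

(** In truth 2 pi: the constant in vol B^(j+2) / vol B^j = 2 pi / (j + 2), which is
    [slice_coef_prod]. *)
Let kappa : R := 2 * (slice_coef R 0 * slice_coef R 1).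

Lemma slice_coef_prod j : j.+2%:R * (slice_coef R j * slice_coef R j.+1) = kappa.
Proof.
elim: j => [//|j IH]; by rewrite -IH [LHS]mulrCA slice_coef_rec; ring.
Qed.

Lemma kappa_gt0 : 0 < kappa.
Proof. by rewrite mulr_gt0// mulr_gt0// slice_coef_gt0. Qed.

(** The factor 2^l rising(1/2, l) = 3 5 ... (2l + 1) cancels the denominators of the odd ball
    volumes; the power of [kappa] that remains is a rescaling of v. *)
Lemma ball_coef_odd l : 2 ^+ l * rising 2^-1 l * ball_coef R l.*2.+1 = ball_coef R 1 * kappa ^+ l.
Proof.
elim: l => [|l IH]; first by rewrite /rising big_ord0 expr0 !mul1r mulr1.
rewrite doubleS risingS [ball_coef R l.*2.+3]ball_coefS [ball_coef R l.*2.+2]ball_coefS.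
have e : 2 * (2^-1 + l.+1%:R) * (slice_coef R l.*2.+1 * slice_coef R l.*2.+2) = kappa.
  rewrite -(slice_coef_prod l.*2.+1); congr (_ * _).
  by rewrite mulrDr divff// -natrM mul2n doubleS nat1r.
rewrite !exprS -[in RHS]e.
transitivity (2 ^+ l * rising 2^-1 l * ball_coef R l.*2.+1 *
   (2 * (2^-1 + l.+1%:R) * (slice_coef R l.*2.+1 * slice_coef R l.*2.+2))); first by ring.
by rewrite IH e; ring.
Qed.

(** Here the same normalisation leaves a factor l!, which is what sets the squeezed ball apart from
    the squeezed cube. *)
Lemma slice_coef_even l : 2 ^+ l * rising 2^-1 l * slice_coef R l.*2 = slice_coef R 0 * 2 ^+ l * l`!%:R.
Proof.
elim: l => [|l IH]; first by rewrite /rising big_ord0 !mul1r !mulr1.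
rewrite doubleS risingS factS natrM !exprS.
have e : 2 * (2^-1 + l.+1%:R) * slice_coef R l.*2.+2 = 2 * l.+1%:R * slice_coef R l.*2.
  have := slice_coef_rec R l.*2.
  have -> : l.*2.+3%:R = 2 * (2^-1 + l.+1%:R) :> R.
    by rewrite mulrDr divff// -natrM mul2n doubleS nat1r.
  by have -> : l.*2.+2%:R = 2 * l.+1%:R :> R by rewrite -natrM mul2n doubleS.
transitivity (2 ^+ l * rising 2^-1 l * (2 * (2^-1 + l.+1%:R) * slice_coef R l.*2.+2)); first by ring.
rewrite e; transitivity (2 * l.+1%:R * (2 ^+ l * rising 2^-1 l * slice_coef R l.*2)); first by ring.
by rewrite IH; ring.
Qed.

Lemma coef_steiner_slab k m i : (k <= m)%N ->
  (steiner_poly (slab R k m))`_(m - k + i) = 'C(k, i)%:R * 2 ^+ (k - i) * ball_coef R (m - k + i).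
Proof.
move=> km; have -> : m = (k + (m - k))%N by rewrite subnKC.
move: (m - k)%N => j; rewrite addKn steiner_slab coef_sum.
have [ik|ki] := leqP i k; last first.
  rewrite bin_small// !mul0r big1// => l _; rewrite coefZ coefXn eqn_add2l.
  by rewrite gtn_eqF ?mulr0// (leq_trans (ltn_ord l)).
rewrite (bigD1 (Ordinal (ik : (i < k.+1)%N))) //= coefZ coefXn eqxx mulr1 big1 ?addr0// => l li.
by rewrite coefZ coefXn eqn_add2l (_ : (i == l) = false) ?mulr0// eq_sym; apply: negbTE.
Qed.

Lemma expr4n l : (4 : R) ^+ l = 2 ^+ l.*2.
Proof. by rewrite -mul2n exprM [2 ^+ 2]expr2 -natrM. Qed.

Lemma posrooted_weylQ_cube n : posrooted (weylQ (unit_cube R n.+1)).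
Proof.
have k0 := kappa_gt0.
have -> : weylQ (unit_cube R n.+1) =
    (2 ^+ n * ball_coef R 1) *: (sinp R n.+1 \Po ((kappa / 4) *: 'X)).
  apply/polyP => l; rewrite coefZ coef_comp_scaleX coef_sinp coef_poly weyl_coefE unit_cube_slab.
  have := @coef_steiner_slab n.+1 n.+1 l.*2.+1 (leqnn _); rewrite subnn !add0n => ->.
  case: ifP => [ln|/negbT ln]; last first.
    by rewrite bin_small ?mulr0//; move: ln; rewrite -leqNgt; lia.
  have -> : 2 ^+ n = 2 ^+ (n.+1 - l.*2.+1) * 4 ^+ l :> R.
    rewrite expr4n -exprD subSS; congr (_ ^+ _); lia.
  transitivity ((-1) ^+ l * 'C(n.+1, l.*2.+1)%:R * 2 ^+ (n.+1 - l.*2.+1) *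
     (2 ^+ l * rising 2^-1 l * ball_coef R l.*2.+1)); first by ring.
  rewrite ball_coef_odd expr_div_n; field; exact: expf_neq0.
apply: posrootedZ; last by apply: posrooted_scale; [exact: divr_gt0|exact: posrooted_sinp].
by rewrite mulf_neq0 ?expf_neq0// gt_eqF// ball_coef_gt0.
Qed.

Lemma posrooted_weylQ_squeezed_cube n : posrooted (weylQ (squeezed (unit_cube R n))).
Proof.
have k0 := kappa_gt0.
have -> : weylQ (squeezed (unit_cube R n)) =
    (2 ^+ n * ball_coef R 1) *: (cosp R n \Po ((kappa / 4) *: 'X)).
  apply/polyP => l; rewrite coefZ coef_comp_scaleX coef_cosp coef_poly weyl_coefE squeezed_cube_slab.
  have := @coef_steiner_slab n n.+1 l.*2 (leqnSn _); rewrite subSnn !add1n => ->.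
  case: ifP => [ln|/negbT ln]; last first.
    by rewrite bin_small ?mulr0//; move: ln; rewrite -leqNgt; lia.
  have -> : 2 ^+ n = 2 ^+ (n - l.*2) * 4 ^+ l :> R.
    rewrite expr4n -exprD; congr (_ ^+ _); lia.
  transitivity ((-1) ^+ l * 'C(n, l.*2)%:R * 2 ^+ (n - l.*2) *
     (2 ^+ l * rising 2^-1 l * ball_coef R l.*2.+1)); first by ring.
  rewrite ball_coef_odd expr_div_n; field; exact: expf_neq0.
apply: posrootedZ; last by apply: posrooted_scale; [exact: divr_gt0|exact: posrooted_cosp].
by rewrite mulf_neq0 ?expf_neq0// gt_eqF// ball_coef_gt0.
Qed.

Lemma weylQ_squeezed_ball n : weylQ (squeezed (unit_ball R n)) =
  (ball_coef R n * slice_coef R 0) *: (cosfactp R n \Po (2 *: 'X)).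
Proof.
apply/polyP => l; rewrite coefZ coef_comp_scaleX coef_cosfactp coef_poly weyl_coefE.
rewrite steiner_squeezed_ball coef_sum.
case: ifP => [ln|/negbT ln]; last first.
  by rewrite bin_small ?mulr0 ?mul0r ?mulr0//; move: ln; rewrite -leqNgt; lia.
have l2 : (l.*2 < n.+1)%N by lia.
rewrite (bigD1 (Ordinal l2)) //= coefZ coefXn eqxx mulr1 big1 ?addr0; last first.
  by move=> i il; rewrite coefZ coefXn eqSS (_ : (l.*2 == i) = false) ?mulr0// eq_sym; apply: negbTE.
transitivity ((-1) ^+ l * ball_coef R n * 'C(n, l.*2)%:R * (2 ^+ l * rising 2^-1 l * slice_coef R l.*2)).
  by ring.
by rewrite slice_coef_even; ring.
Qed.

Lemma conservative_squeezed_ball n p : (0 < p)%N ->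
  posrooted (laguerre_mult (p%:R / 2) (cosfactp R n)) ->
  conservative (weyl_poly (squeezed (unit_ball R n)) p).
Proof.
move=> p0 pr; apply: conservative_weyl_poly => //.
rewrite weylQ_squeezed_ball laguerre_multZ.
apply: posrootedZ; first by rewrite mulf_neq0// gt_eqF// ?ball_coef_gt0 ?slice_coef_gt0.
have -> : laguerre_mult (p%:R / 2) (cosfactp R n \Po (2 *: 'X)) =
    laguerre_mult (p%:R / 2) (cosfactp R n) \Po (2 *: 'X).
  by apply/polyP => l; rewrite coef_laguerre_mult !coef_comp_scaleX coef_laguerre_mult mulrA.
exact: posrooted_scale.
Qed.

Lemma fact_rising_odd l : l.*2.+1`!%:R = 4 ^+ l * l`!%:R * rising 2^-1 l :> R.
Proof.
elim: l => [|l IH]; first by rewrite /rising big_ord0 !mulr1.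
rewrite doubleS [(l.*2.+3)`!]factS [(l.*2.+2)`!]factS [l.+1`!]factS.
move: (l.*2.+1)`! (l`!) IH => F G IH; rewrite !natrM IH risingS exprS.
have -> : l.*2.+3%:R = 2 * (2^-1 + l.+1%:R) :> R.
  by rewrite mulrDr divff// -natrM mul2n doubleS nat1r.
have -> : l.*2.+2%:R = 2 * l.+1%:R :> R by rewrite -natrM mul2n doubleS.
by ring.
Qed.

Lemma fact_rising_even l : l.*2`!%:R = 4 ^+ l * l`!%:R * rising (- 2^-1) l :> R.
Proof.
elim: l => [|l IH]; first by rewrite /rising big_ord0 !mulr1.
rewrite doubleS [(l.*2.+2)`!]factS [(l.*2.+1)`!]factS [l.+1`!]factS.
move: (l.*2)`! (l`!) IH => F G IH; rewrite !natrM IH risingS exprS.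
have -> : l.*2.+2%:R = 2 * l.+1%:R :> R by rewrite -natrM mul2n doubleS.
have -> : l.*2.+1%:R = 2 * (- 2^-1 + l.+1%:R) :> R.
  by rewrite mulrDr mulrN divff// -natrM mul2n doubleS -[l.*2.+2%:R]natr1 addrC addrK.
by ring.
Qed.

Lemma coef_exp1D (c : R) d j : ((1 + c *: 'X) ^+ d)`_j = 'C(d, j)%:R * c ^+ j.
Proof.
rewrite exprDn coef_sum.
under eq_bigr do rewrite expr1n mul1r exprZn -scaler_nat scalerA coefZ coefXn.
have [jd|dj] := leqP j d; last first.
  rewrite bin_small// mul0r big1// => i _.
  by rewrite gtn_eqF ?mulr0// (leq_trans (ltn_ord i)).
rewrite (bigD1 (Ordinal (jd : (j < d.+1)%N))) //= eqxx mulr1 big1 ?addr0// => i ij.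
by rewrite (_ : (j == i) = false) ?mulr0// eq_sym; apply: negbTE.
Qed.

(* The reversed polynomial is a Laguerre polynomial, of parameter -1/2 or 1/2. *)
Lemma posrooted_weylQ_ball n : posrooted (weylQ (unit_ball R n.+1)).
Proof.
pose d := n./2; pose a : R := if odd n then 2^-1 else - 2^-1.
have a1 : -1 < a by rewrite /a; case: odd; lra.
(* C(n + 1, 2l + 1) has the denominator (2l + 1)! (n - 2l)!. In the first factorial [rising 2^-1 l]
   cancels the Weyl normalisation. The second leaves [rising a (d - l)], where [a] depends on the
   parity of n - 2l, that is of n. *)
have fE l : (l <= d)%N -> (n - (d - l).*2)`!%:R = 4 ^+ l * l`!%:R * rising a l :> R.
  move=> ld; rewrite /a; have := odd_double_half n; rewrite -/d; case: odd => /= nd.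
    by rewrite -fact_rising_odd; congr (_ `!%:R); lia.
  by rewrite -fact_rising_even; congr (_ `!%:R); lia.
pose P := laguerre_mult a (\prod_(r <- nseq d 2^-1) (1 - r *: 'X)).
have pP : posrooted P.
  by apply: posrooted_laguerre_prod => //; apply/allP => x /nseqP[-> _].
have PE j : P`_j = 'C(d, j)%:R * (- 2^-1) ^+ j / rising a j.
  rewrite /P coef_laguerre_mult; congr (_ / _).
  by rewrite big_nseq iter_mulr_1 -scaleNr coef_exp1D.
have sP : size P = d.+1.
  apply/eqP; rewrite eqn_leq; apply/andP; split.
    by apply/leq_sizeP => j dj; rewrite PE bin_small// !mul0r.
  rewrite ltnNge; apply/negP => /leq_sizeP/(_ d (leqnn _)); rewrite PE binn mul1r => /eqP.
  rewrite mulf_eq0 invr_eq0 expf_eq0 oppr_eq0 invr_eq0 pnatr_eq0 andbF /=.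
  by rewrite gt_eqF// rising_gt0.
pose K : R := ball_coef R n.+1 * n.+1`!%:R / (2 ^+ d * d`!%:R) * (-1) ^+ d.
have K0 : K != 0.
  rewrite !mulf_neq0 ?signr_eq0 ?invr_eq0 ?mulf_neq0 ?expf_neq0 ?pnatr_eq0 -?lt0n ?fact_gt0//.
  by rewrite gt_eqF// ball_coef_gt0.
apply: (@posrooted_rev _ (K *: P) _ d); last exact: posrootedZ.
- by rewrite size_scale.
- exact: size_poly.
move=> l ld; rewrite coef_poly ltnS ld coefZ PE weyl_coefE steiner_unit_ball coefZ.
have X1 : 'X = 1 *: 'X :> {poly R} by rewrite scale1r.
rewrite X1 coef_exp1D expr1n mulr1.
pose j := (d - l)%N; have jd : (j <= d)%N by exact: leq_subr.
have dE : d = (l + j)%N by rewrite subnKC.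
have := fE j jd; rewrite subKn// => f2.
have f1 := fact_rising_odd l.
have b1 : 'C(n.+1, l.*2.+1)%:R * (l.*2.+1`!%:R * (n - l.*2)`!%:R) = n.+1`!%:R :> R.
  by rewrite -!natrM -subSS bin_fact// ltnS; move: ld; rewrite /d; lia.
have b2 : 'C(d, j)%:R * (j`!%:R * l`!%:R) = d`!%:R :> R.
  by rewrite -!natrM -(bin_fact jd) subKn.
have fn k : k`!%:R != 0 :> R by rewrite pnatr_eq0 -lt0n fact_gt0.
have r1 : rising 2^-1 l != 0 :> R by rewrite gt_eqF// rising_gt0//; lra.
have r2 : rising a j != 0 by rewrite gt_eqF// rising_gt0.
have p2 k : (2 : R) ^+ k != 0 by rewrite expf_neq0.
have e1 : (- 2^-1 : R) ^+ j = (-1) ^+ j / 2 ^+ j by rewrite -exprVn -exprMn mulN1r.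
have e2 : (2 : R) ^+ d = 2 ^+ l * 2 ^+ j by rewrite [in LHS]dE exprD.
have e3 : (-1 : R) ^+ d = (-1) ^+ l * (-1) ^+ j by rewrite [in LHS]dE exprD.
have s1 : (-1) ^+ j * (-1) ^+ j = 1 :> R by rewrite -expr2 sqrr_sign.
have e4 k : (4 : R) ^+ k = 2 ^+ k * 2 ^+ k by rewrite expr4n -addnn exprD.
rewrite -/j /K -b1 f1 f2 -b2 !e4 e1 e2 e3.
have c0 : 'C(d, j)%:R != 0 :> R by rewrite pnatr_eq0 -lt0n bin_gt0.
move: (fn l) (fn j) (p2 l) (p2 j) s1 r1 r2 c0.
move: (l`!%:R : R) (j`!%:R : R) (2 ^+ l : R) (2 ^+ j : R) ((-1) ^+ j : R) ((-1) ^+ l : R).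
move: ('C(n.+1, l.*2.+1)%:R : R) ('C(d, j)%:R : R) (rising 2^-1 l : R) (rising a j) (ball_coef R n.+1 : R).
move=> bn bd r r' w L J x y s s' L0 J0 x0 y0 s1 r0 r'0 bd0.
transitivity (s' * (s * s) * (x * r * (w * bn))); first by rewrite s1 mulr1; ring.
by field; rewrite bd0 L0 J0 x0 y0 r'0.
Qed.

End weyl.

Theorem theorem2p9 (R : realType) (n : nat) (n_gt0 : (1 <= n)%N) :
  [/\ conservative (weyl_poly_inf (unit_ball R n.+1)) /\
      (forall p : nat, (1 <= p)%N ->
         conservative (weyl_poly (unit_ball R n.+1) p)),
      [/\ conservative (weyl_poly (squeezed (unit_ball R n)) 1),
          conservative (weyl_poly (squeezed (unit_ball R n)) 2) &
          conservative (weyl_poly (squeezed (unit_ball R n)) 4)],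
      conservative (weyl_poly_inf (unit_cube R n.+1)) /\
      (forall p : nat, (1 <= p)%N ->
         conservative (weyl_poly (unit_cube R n.+1) p)) &
      conservative (weyl_poly_inf (squeezed (unit_cube R n))) /\
      (forall p : nat, (1 <= p)%N ->
         conservative (weyl_poly (squeezed (unit_cube R n)) p))].
Proof.
split.
- exact/conservative_weyl/posrooted_weylQ_ball.
- split; apply: conservative_squeezed_ball => //.
  + by rewrite div1r; exact: posrooted_cosfactp1.
  + by rewrite divff//; exact: posrooted_cosfactp2.
  + have -> : 4 / 2 = 2 :> R by field.
    exact: posrooted_cosfactp4.
- exact/conservative_weyl/posrooted_weylQ_cube.
- exact/conservative_weyl/posrooted_weylQ_squeezed_cube.
Qed.
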